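(* Let $J$ be the functional $$J(y)=\int_a^b L\big(x,y(x),{}_a^{C}D_x^\alpha y(x),{}_aI_x^\beta y(x),z(x), y(x-\tau), y'(x-\tau)\big)\,dx,\qquad z(x)=\int_a^x l\big(t,y(t),{}_a^{C}D_t^\alpha y(t),{}_aI_t^\beta y(t)\big)\,dt,$$ where $\alpha\in(0,1)$, $\beta>0$, $0<\tau<b-a$, and $L=L(x,y,v,w,z,y_\tau,v_\tau)$ and $l=l(x,y,v,w)$ are of class $C^1$, considered on the set of admissible functions (described in the context). Let $y$ be an admissible function satisfying the following three conditions: (i) $\displaystyle \frac{\partial L}{\partial v_\tau}[y](b)=0$; (ii) for every $x\in[a,b-\tau]$, $$\begin{aligned} &\frac{\partial L}{\partial y}[y](x)+{}_xD^\alpha_{b-\tau}\left( \frac{\partial L}{\partial v}[y](x) \right) - \frac{1}{\Gamma(1-\alpha)}\, \frac{d}{dx}\left( \int_{b-\tau}^b(t-x)^{-\alpha} \frac{\partial L}{\partial v}[y](t)\,dt\right)\\ &\quad +{}_xI_{b-\tau}^\beta\left(\frac{\partial L}{\partial w}[y](x)\right) +\frac{1}{\Gamma(\beta)} \int_{b-\tau}^b (t-x)^{\beta-1} \frac{\partial L}{\partial w}[y](t)\,dt +\left(\int_x^b \frac{\partial L}{\partial z}[y](t)\,dt\right) \frac{\partial l}{\partial y}\{y\}(x)\\ &\quad+{}_xD^\alpha_{b-\tau}\left( \left(\int_x^b \frac{\partial L}{\partial z}[y](t)\,dt\right) \frac{\partial l}{\partial v}\{y\}(x)\right) -\frac{1}{\Gamma(1-\alpha)}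 \frac{d}{dx} \left( \int_{b-\tau}^b(t-x)^{-\alpha}\left(\int_t^b \frac{\partial L}{\partial z}[y](k)\,dk\right) \frac{\partial l}{\partial v}\{y\}(t)\,dt \right)\\ &\quad +{}_xI^\beta_{b-\tau}\left( \left(\int_x^b \frac{\partial L}{\partial z}[y](t)\,dt\right) \frac{\partial l}{\partial w}\{y\}(x) \right) +\frac{1}{\Gamma(\beta)} \int_{b-\tau}^b (t-x)^{\beta-1}\left(\int_t^b \frac{\partial L}{\partial z}[y](k)\,dk\right) \frac{\partial l}{\partial w}\{y\}(t)\,dt\\ & \quad +\frac{\partial L}{\partial y_\tau}[y](x+\tau) -\frac{d}{dx}\left(\frac{\partial L}{\partial v_\tau}[y](x+\tau)\right)=0; \end{aligned}$$ (iii) for every $x\in[b-\tau,b]$, $$\begin{aligned} &\frac{\partial L}{\partial y}[y](x)+{}_xD^\alpha_b\left( \frac{\partial L}{\partial v}[y](x) \right)+{}_xI_b^\beta\left(\frac{\partial L}{\partial w}[y](x)\right) +\left(\int_x^b \frac{\partial L}{\partial z}[y](t)\,dt\right) \frac{\partial l}{\partial y}\{y\}(x)\\ &\quad+{}_xD^\alpha_b\left( \left(\int_x^b \frac{\partial L}{\partial z}[y](t)\,dt\right) \frac{\partial l}{\partial v}\{y\}(x)\right) +{}_xI^\beta_b\left( \left(\int_x^b \frac{\partial L}{\partial z}[y](t)\,dt\right) \frac{\partial l}{\partial w}\{y\}(x) \right)=0. \end{aligned}$$ If $L$ is convex in $(y,v,w,z,y_\tau,v_\tau)$ and one of the two following conditions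 is met: 1. $l$ is convex in $(y,v,w)$ and $\frac{\partial L}{\partial z}[y](x)\geq 0$ for all $x\in[a,b]$, 2. $l$ is concave in $(y,v,w)$ and $\frac{\partial L}{\partial z}[y](x)\leq 0$ for all $x\in[a,b]$, then $y$ is a minimizer of the functional $J$ among the admissible functions.
   Context: Fractional operators, for $\alpha\in(0,1)$, $\beta>0$ and endpoints $a$, $c$ (with $c=b$ or $c=b-\tau$): $${}_aI_x^\beta f(x)=\frac{1}{\Gamma(\beta)}\int_a^x (x-t)^{\beta-1}f(t)\,dt,\qquad {}_xI_c^\beta f(x)=\frac{1}{\Gamma(\beta)}\int_x^c(t-x)^{\beta-1} f(t)\,dt$$ (left and right fractional integrals), $${}_xD_c^\alpha f(x)=\frac{-1}{\Gamma(1-\alpha)}\frac{d}{dx}\int_x^c (t-x)^{-\alpha} f(t)\,dt$$ (right Riemann--Liouville derivative), and $${}_a^{C}D_x^\alpha f(x)=\frac{1}{\Gamma(1-\alpha)}\int_a^x (x-t)^{-\alpha}f'(t)\,dt$$ (left Caputo derivative). An expression such as ${}_xD^\alpha_c(F(x))$ or ${}_xI^\beta_c(F(x))$ means the operator applied to the function $x\mapsto F(x)$, evaluated at $x$. Admissible functions: those $y\in C^1[a-\tau,b]$ such that ${}_a^{C}D_x^\alpha y(x)$ and ${}_aI_x^\beta y(x)$ exist and are continuous on $[a,b]$, $y(b)=y_b$ for a fixed $y_b\in\mathbb{R}$, and $y(x)=\phi(x)$ for all $x\in[a-\tau,a]$, where $\phi$ is a fixed function. Notation: $[y](x)=\big(x,y(x),{}_a^{C}D_x^\alpha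 y(x),{}_aI_x^\beta y(x),z(x),y(x-\tau),y'(x-\tau)\big)$ and $\{y\}(x)=\big(x,y(x),{}_a^{C}D_x^\alpha y(x),{}_aI_x^\beta y(x)\big)$. The partial derivatives of $L$ and $l$ are with respect to their arguments, named as $L(x,y,v,w,z,y_\tau,v_\tau)$ and $l(x,y,v,w)$; $\frac{\partial L}{\partial v}[y](x)$ denotes the partial derivative evaluated at the point $[y](x)$, $\frac{\partial l}{\partial v}\{y\}(x)$ the one evaluated at $\{y\}(x)$, and similarly for the other variables; $[y](x+\tau)$ is $[y]$ evaluated at $x+\tau$. Convexity: given $k\in\{1,\ldots,n\}$ and $f:D\subseteq\mathbb{R}^n\to\mathbb{R}$ differentiable with respect to $x_k,\ldots,x_n$, $f$ is convex (resp. concave) in $(x_k,\ldots,x_n)$ if $$f(x_1,\ldots,x_{k-1},x_k+c_k,\ldots,x_n+c_n)-f(x_1,\ldots,x_n)\ \geq\ (\text{resp. }\leq)\ \sum_{i=k}^n\frac{\partial f}{\partial x_i}(x_1,\ldots,x_n)\,c_i$$ for all $(x_1,\ldots,x_n)$ and $(x_1,\ldots,x_{k-1},x_k+c_k,\ldots,x_n+c_n)$ in $D$. *)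

(* Defs.v *)
From HB Require Import structures.
From mathcomp Require Import all_boot all_order all_algebra.
From mathcomp Require Import all_classical all_reals all_analysis.

Set Implicit Arguments.
Unset Strict Implicit.
Unset Printing Implicit Defensive.

Import Order.TTheory GRing.Theory Num.Theory.
Import numFieldNormedType.Exports.

Local Open Scope classical_set_scope.
Local Open Scope ring_scope.

(* Directional derivatives relative to a set A: same difference quotient as
   [derivable] and ['D_v f p], but with the increment h restricted to the
   values that keep the point in A.  When A is a neighbourhood of p these are
   [derivable f p v] and ['D_v f p]; when A is an interval of R, v = 1 and p is
   an endpoint, this is the one-sided derivative. *)
Section DerivativeIn.
Variables (R : realType) (V : normedModType R).
Implicit Types (A : set V) (f : V -> R) (p v : V).

Definition quotient_filter_in A f p v : set_system R :=
  (h^-1 *: (f (h *: v + p) - f p)) @[h --> within [set h | A (h *: v + p)] 0^'].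

Definition derivable_in A f p v : Prop := cvg (quotient_filter_in A f p v).

Definition derive_in A f p v : R := lim (quotient_filter_in A f p v).

End DerivativeIn.

Definition derivable1_in (R : realType) (A : set R) (f : R -> R) (x : R) :=
  derivable_in A f x (1 : R).

Definition derive1_in (R : realType) (A : set R) (f : R -> R) (x : R) : R :=
  derive_in A f x (1 : R).

Definition C1_itv (R : realType) (A : set R) (f : R -> R) : Prop :=
  (forall x, A x -> derivable1_in A f x) /\
  {within A, continuous (derive1_in A f)}.

(* Coordinates are numbered from 0. *)
Section SeveralVariables.
Variables (R : realType) (n : nat).
Implicit Types (D : set 'rV[R]_n) (f : 'rV[R]_n -> R).

Definition partial D f (i : 'I_n) (p : 'rV[R]_n) : R :=
  derive_in D f p (delta_mx 0 i).

Definition C1_on D f : Prop := forall i : 'I_n,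
  (forall p, D p -> derivable_in D f p (delta_mx 0 i)) /\
  {within D, continuous (partial D f i)}.

Definition convex_from (k : 'I_n) D f : Prop :=
  (forall (i : 'I_n) p, (k <= i)%N -> D p ->
     derivable_in D f p (delta_mx 0 i)) /\
  forall p q, D p -> D q -> (forall i : 'I_n, (i < k)%N -> q 0 i = p 0 i) ->
    \sum_(i < n | (k <= i)%N) partial D f i p * (q 0 i - p 0 i) <= f q - f p.

Definition concave_from (k : 'I_n) D f : Prop :=
  (forall (i : 'I_n) p, (k <= i)%N -> D p ->
     derivable_in D f p (delta_mx 0 i)) /\
  forall p q, D p -> D q -> (forall i : 'I_n, (i < k)%N -> q 0 i = p 0 i) ->
    f q - f p <= \sum_(i < n | (k <= i)%N) partial D f i p * (q 0 i - p 0 i).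

End SeveralVariables.

(* The domain [a, b] x R^n of the Lagrangians. *)
Definition slab (R : realType) (n : nat) (a b : R) : set 'rV[R]_n.+1 :=
  [set p | a <= p 0 0 <= b].

Section FractionalOperators.
Variable R : realType.
Local Notation mu := (@lebesgue_measure R).
Implicit Types (A : set R) (f : R -> R) (alpha beta a c x s : R).

Definition Gamma s : R :=
  \int[mu]_(t in `]0, +oo[) (t `^ (s - 1) * expR (- t)).

Definition left_integral beta a f x : R :=
  (Gamma beta)^-1 * \int[mu]_(t in `[a, x]) ((x - t) `^ (beta - 1) * f t).

Definition right_integral beta c f x : R :=
  (Gamma beta)^-1 * \int[mu]_(t in `[x, c]) ((t - x) `^ (beta - 1) * f t).

(* The function differentiated in the right Riemann-Liouville derivative. *)
Definition right_kernel alpha c f x : R :=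
  \int[mu]_(t in `[x, c]) ((t - x) `^ (- alpha) * f t).

(* A is the interval over which x ranges: d/dx is one-sided at its endpoints. *)
Definition right_RL alpha c A f x : R :=
  - (Gamma (1 - alpha))^-1 * derive1_in A (right_kernel alpha c f) x.

(* A is the interval on which f is defined. *)
Definition left_Caputo alpha a A f x : R :=
  (Gamma (1 - alpha))^-1 *
  \int[mu]_(t in `[a, x]) ((x - t) `^ (- alpha) * derive1_in A f t).

Definition left_integral_exists beta a f x : Prop :=
  mu.-integrable `[a, x] (fun t => ((x - t) `^ (beta - 1) * f t)%:E).

Definition left_Caputo_exists alpha a A f x : Prop :=
  mu.-integrable `[a, x]
    (fun t => ((x - t) `^ (- alpha) * derive1_in A f t)%:E).

End FractionalOperators.

Section DelayProblem.
Variables (R : realType) (a b tau alpha beta : R).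
Variables (L : 'rV[R]_7 -> R) (l : 'rV[R]_4 -> R).
Local Notation mu := (@lebesgue_measure R).
Implicit Types (y : R -> R) (x : R).

Definition dom : set R := `[a - tau, b].

Definition admissible (yb : R) (phi : R -> R) y : Prop :=
  [/\ C1_itv dom y,
      (forall x, a <= x <= b -> left_Caputo_exists alpha a dom y x) /\
        {within `[a, b], continuous (left_Caputo alpha a dom y)},
      (forall x, a <= x <= b -> left_integral_exists beta a y x) /\
        {within `[a, b], continuous (left_integral beta a y)},
      y b = yb
    & forall x, a - tau <= x <= a -> y x = phi x].

(* {y}(x), with coordinates 0 : x, 1 : y, 2 : v, 3 : w *)
Definition braces y x : 'rV[R]_4 :=
  \row_(i < 4)
    [:: x; y x; left_Caputo alpha a dom y x; left_integral beta a y x]`_i.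

Definition zfun y x : R := \int[mu]_(t in `[a, x]) l (braces y t).

(* [y](x), with coordinates
   0 : x, 1 : y, 2 : v, 3 : w, 4 : z, 5 : y_tau, 6 : v_tau *)
Definition brackets y x : 'rV[R]_7 :=
  \row_(i < 7)
    [:: x; y x; left_Caputo alpha a dom y x; left_integral beta a y x;
        zfun y x; y (x - tau); derive1_in dom y (x - tau)]`_i.

Definition J y : R := \int[mu]_(x in `[a, b]) L (brackets y x).

Definition dL (i : 'I_7) y x : R := partial (slab a b) L i (brackets y x).

Definition dl (i : 'I_4) y x : R := partial (slab a b) l i (braces y x).

Definition intLz y x : R := \int[mu]_(t in `[x, b]) dL 4 y t.

Definition boundary_condition y : Prop := dL 6 y b = 0.

Definition Euler_Lagrange_before y : Prop :=
  let A := [set` `[a, b - tau]] in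
  let Lv := dL 2 y in
  let Lw := dL 3 y in
  let Zlv := fun x => intLz y x * dl 2 y x in
  let Zlw := fun x => intLz y x * dl 3 y x in
  let tail := fun (e : R) (f : R -> R) (x : R) =>
    \int[mu]_(t in `[b - tau, b]) ((t - x) `^ e * f t) in
  let Lvtau := fun x => dL 6 y (x + tau) in
  forall x, a <= x <= b - tau ->
  (* the derivatives d/dx occurring in the equation exist *)
  [/\ derivable1_in A (right_kernel alpha (b - tau) Lv) x,
      derivable1_in A (tail (- alpha) Lv) x,
      derivable1_in A (right_kernel alpha (b - tau) Zlv) x,
      derivable1_in A (tail (- alpha) Zlv) x
    & derivable1_in A Lvtau x] /\
  dL 1 y x
  + right_RL alpha (b - tau) A Lv x
  - (Gamma (1 - alpha))^-1 * derive1_in A (tail (- alpha) Lv) x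
  + right_integral beta (b - tau) Lw x
  + (Gamma beta)^-1 * tail (beta - 1) Lw x
  + intLz y x * dl 1 y x
  + right_RL alpha (b - tau) A Zlv x
  - (Gamma (1 - alpha))^-1 * derive1_in A (tail (- alpha) Zlv) x
  + right_integral beta (b - tau) Zlw x
  + (Gamma beta)^-1 * tail (beta - 1) Zlw x
  + dL 5 y (x + tau)
  - derive1_in A Lvtau x = 0.

Definition Euler_Lagrange_after y : Prop :=
  let A := [set` `[b - tau, b]] in
  let Lv := dL 2 y in
  let Lw := dL 3 y in
  let Zlv := fun x => intLz y x * dl 2 y x in
  let Zlw := fun x => intLz y x * dl 3 y x in
  forall x, b - tau <= x <= b ->
  (* the derivatives d/dx occurring in the equation exist *)
  [/\ derivable1_in A (right_kernel alpha b Lv) x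
    & derivable1_in A (right_kernel alpha b Zlv) x] /\
  dL 1 y x
  + right_RL alpha b A Lv x
  + right_integral beta b Lw x
  + intLz y x * dl 1 y x
  + right_RL alpha b A Zlv x
  + right_integral beta b Zlw x = 0.

End DelayProblem.

(* Main.v *)
Require Import Defs.
From HB Require Import structures.
From mathcomp Require Import all_boot all_order all_algebra.
From mathcomp Require Import all_classical all_reals all_analysis.
From mathcomp Require Import measurable_realfun ring lra.

(* For a competitor yt put eta := yt - y. Convexity of L bounds J yt - J y from
   below by the integral of the gradient of L at [y] against the increments of
   its arguments; in the increment of z, convexity (or concavity) of l together
   with the sign of dL/dz bounds dL/dz times it from below by its linearization
   in eta. The linearized integral vanishes: Fubini's theorem moves the
   fractional operators from eta to the coefficients (the iterated integral z is
   the case of the constant kernel), the delayed terms are translated by tau,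
   and an integration by parts on each of [a, b - tau] and [b - tau, b] leaves
   the Euler-Lagrange expressions and boundary terms that cancel.

   Only the sum of the derivatives in (ii) can be integrated by parts: the
   equation itself identifies that sum with a continuous function, whereas the
   individual terms are merely assumed to exist. *)

Set Implicit Arguments.
Unset Strict Implicit.
Unset Printing Implicit Defensive.

Import Order.TTheory GRing.Theory Num.Theory.
Import numFieldNormedType.Exports.

Local Open Scope classical_set_scope.
Local Open Scope ring_scope.

(** * Derivatives within a set *)

(** The integral is a total operation, so no sum under it may be split before integrability is
    known; continuity on a compact interval is the main source of it. Two preliminary results are
    forced by this. [C1_on] speaks only of partial derivatives within the slab, so continuity of L
    and l themselves has to be derived. And right fractional integrals of continuous functions have
    to be shown continuous in spite of their singular kernel.

    All kernels are powers with an exponent p > -1: -alpha for the Caputo derivative, beta - 1 for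
    the fractional integral, 0 for z. One duality statement and one continuity statement therefore
    serve all three operators, and the Gamma factors remain inert constants.

    The functions differentiated on [a, b - tau] and on [b - tau, b] differ by the delayed term
    dL/dv_tau[y](x + tau). This is why the two intervals are treated separately: at x = b - tau the
    common part of the boundary terms cancels, and the delayed term becomes dL/dv_tau[y](b), which
    condition (i) annihilates. *)

Section derivatives_within.
Context {R : realType}.

Lemma quotient_filter_in_comp_line (V : normedModType R) (A : set V)
    (f : V -> R) (r v : V) (s : R) :
  quotient_filter_in [set t : R | A (t *: v + r)] (fun t => f (t *: v + r)) s 1
  = quotient_filter_in A f (s *: v + r) v.
Proof.
rewrite /quotient_filter_in.
have E h : (h *: (1 : R) + s) *: v + r = h *: v + (s *: v + r).
  by rewrite scalerDl [h *: 1]mulr1 addrA.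
have -> : [set h : R | [set t : R | A (t *: v + r)] (h *: 1 + s)]
  = [set h : R | A (h *: v + (s *: v + r))].
  by apply/funext => h /=; rewrite E.
by f_equal; apply/funext => h /=; rewrite E.
Qed.

Implicit Types (A B : set R) (f g : R -> R) (x d : R).

Lemma quotient_filter_inS A B f x d : A `<=` B ->
  quotient_filter_in B f x 1 --> d -> quotient_filter_in A f x 1 --> d.
Proof.
move=> AB; apply: cvg_trans; apply: cvg_app; apply: within_subset => h /=.
exact: AB.
Qed.

Lemma eq_quotient_filter_in A f g x d : A x -> {in A, f =1 g} ->
  quotient_filter_in A f x 1 --> d -> quotient_filter_in A g x 1 --> d.
Proof.
move=> Ax fg; apply: cvg_trans; apply: fmap_within_eq => h; rewrite inE /= => Ah.
by rewrite !fg ?inE.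
Qed.

Lemma quotient_filter_inD A f g x d e :
  quotient_filter_in A f x 1 --> d -> quotient_filter_in A g x 1 --> e ->
  quotient_filter_in A (fun t => f t + g t) x 1 --> d + e.
Proof.
move=> fd ge; rewrite (_ : quotient_filter_in A (fun t => f t + g t) x 1 =
  (h^-1 *: (f (h *: 1 + x) - f x) + h^-1 *: (g (h *: 1 + x) - g x))
    @[h --> within [set h | A (h *: 1 + x)] 0^']); first exact: cvgD.
rewrite /quotient_filter_in; f_equal; apply/funext => h.
by rewrite -scalerDr opprD addrACA.
Qed.

Lemma quotient_filter_inZ A f k x d : quotient_filter_in A f x 1 --> d ->
  quotient_filter_in A (fun t => k * f t) x 1 --> k * d.
Proof.
move=> fd; rewrite (_ : quotient_filter_in A (fun t => k * f t) x 1 =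
  (k * (h^-1 *: (f (h *: 1 + x) - f x)))
    @[h --> within [set h | A (h *: 1 + x)] 0^']); first exact: cvgMr.
rewrite /quotient_filter_in; f_equal; apply/funext => h.
by rewrite -mulrBr /GRing.scale/= mulrCA.
Qed.

Lemma quotient_filter_in_continuous A f x d :
  quotient_filter_in A f x 1 --> d -> f @ within A (nbhs x) --> f x.
Proof.
move=> fd; have /nbhs_ballP[r /= r0 {}fd] := fd _ (nbhsx_ballx d 1 ltr01).
apply/cvgrPdist_lt => e e0.
(* Within distance r the quotient differs from d by less than 1, so |f t - f x| < (1 + |d|) |t -
   x|. *)
exists (Num.min r (e / (1 + `|d|))); rewrite /= ?lt_min ?r0 ?divr_gt0 ?ltr_pwDl// => t.
rewrite /ball_/= lt_min => /andP[tr te] At.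
have [->|tx] := eqVneq t x; first by rewrite subrr normr0.
have h0 : t - x != 0 by rewrite subr_eq0.
have := fd (t - x); rewrite /ball/= sub0r normrN distrC => /(_ tr h0).
rewrite [_%:A]mulr1 subrK => /(_ At) H.
have {H} : `|(t - x)^-1 *: (f t - f x)| < 1 + `|d|.
  rewrite -[X in `|X|](subrK d) (le_lt_trans (ler_normD _ _))// ltrD2r distrC.
  exact: H.
rewrite normrM normfV ltr_pdivrMl ?normr_gt0// distrC => /lt_trans; apply.
by rewrite -ltr_pdivlMr ?ltr_pwDl// distrC.
Qed.

(** At an interior point every small enough increment stays in [u, v], so the restriction on h is
    vacuous near 0. *)
Lemma quotient_filter_in_is_derive (u v : R) f x d : u < x < v ->
  quotient_filter_in `[u, v] f x 1 --> d -> is_derive x 1 f d.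
Proof.
move=> /andP[ux xv] fd.
have {}fd : (h^-1 *: (f (h *: 1 + x) - f x)) @[h --> 0^'] --> d.
  apply: cvg_trans fd; apply: cvg_app => P.
  have : \forall h \near (0 : R)^', `[u, v]%classic (h *: (1 : R) + x).
    exists (Num.min (x - u) (v - x)) => /=; first by rewrite lt_min !subr_gt0 ux.
    move=> h; rewrite /ball_/= sub0r normrN lt_min => /andP[h1 h2] _.
    rewrite [_%:A]mulr1 in_itv/=.
    by have := ler_norm h; have := ler_norm (- h); rewrite normrN; lra.
  by move=> nA H; apply: filterS2 nA H => h Ah; exact.
by apply: DeriveDef; [apply/cvg_ex; exists d; exact: fd|exact/cvg_lim].
Qed.

Lemma quotient_filter_in_mean_value (u v : R) f f' C : u <= v ->
  (forall s, u <= s <= v -> quotient_filter_in `[u, v] f s 1 --> (f' s : R)) ->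
  (forall s, u <= s <= v -> `|f' s| <= C) -> `|f v - f u| <= C * (v - u).
Proof.
move=> uv df f'C.
have [s us|s|c] := @MVT_segment R f f' u v uv.
- move: (us); rewrite in_itv => /quotient_filter_in_is_derive; apply; apply: df.
  by rewrite !(itvP us).
- have : {within `[u, v], continuous f}; last exact.
  apply/subspace_continuousP => {}s/=; rewrite in_itv/= => us.
  exact: quotient_filter_in_continuous (df _ us).
- rewrite in_itv/= => uc ->; rewrite normrM (ger0_norm (x := v - u)) ?subr_ge0//.
  by rewrite ler_wpM2r ?subr_ge0// f'C.
Qed.

End derivatives_within.

(** * Continuity of C^1 functions on the slab *)

Section C1_slab.
Context {R : realType} (n : nat).
Implicit Types (D : set 'rV[R]_n.+1) (f : 'rV[R]_n.+1 -> R) (p q z : 'rV[R]_n.+1).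

(** Along the segment from p to q, f is a function of the i-th coordinate alone and its derivative
    is the partial derivative, so the one-variable mean value inequality applies. A derivative
    within D restricts to a derivative within the segment, hence boundary points of D are
    allowed. *)
Lemma partial_mean_value D f (i : 'I_n.+1) p q C :
  (forall j, j != i -> p 0 j = q 0 j) ->
  (forall z, (forall j, j != i -> z 0 j = p 0 j) ->
    Num.min (p 0 i) (q 0 i) <= z 0 i <= Num.max (p 0 i) (q 0 i) ->
    [/\ D z, derivable_in D f z (delta_mx 0 i) & `|partial D f i z| <= C]) ->
  `|f q - f p| <= C * `|q 0 i - p 0 i|.
Proof.
wlog pq : p q / p 0 i <= q 0 i.
  move=> H Epq Hz; have [/H|/ltW qp] := leP (p 0 i) (q 0 i); first exact.
  rewrite distrC (distrC (q 0 i)); apply: H => // [j ji|z zq zi].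
    by rewrite Epq.
  by apply: Hz => [j ji|]; [rewrite zq// Epq|rewrite minC maxC].
rewrite min_l// max_r// (ger0_norm (x := q 0 i - p 0 i)) ?subr_ge0// => Epq Hz.
pose e : 'rV[R]_n.+1 := delta_mx 0 i.
(* With the i-th coordinate set to 0, the parameter s of the line is the i-th coordinate itself. *)
pose base := p - p 0 i *: e.
have lineE s j : (s *: e + base) 0 j = if j == i then s else p 0 j.
  rewrite !mxE eqxx/= eq_sym; case: eqVneq => [->|_].
    by rewrite !mulr1 subrr addr0.
  by rewrite !mulr0 subr0 add0r.
have -> : f p = f (p 0 i *: e + base).
  by congr f; apply/rowP => j; rewrite lineE; case: eqVneq => // ->.
have -> : f q = f (q 0 i *: e + base).
  by congr f; apply/rowP => j; rewrite lineE; case: eqVneq => [->|/Epq].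
have seg s : p 0 i <= s <= q 0 i ->
    [/\ D (s *: e + base), derivable_in D f (s *: e + base) e
      & `|partial D f i (s *: e + base)| <= C].
  by move=> ps; apply: Hz => [j /negPf ji|]; rewrite lineE ?ji ?eqxx.
apply: (quotient_filter_in_mean_value (f := fun s => f (s *: e + base)) pq
    (f' := fun s => partial D f i (s *: e + base))) => [s /[dup] ps /seg[_ df _]|].
  apply: (@quotient_filter_inS _ _ [set t | D (t *: e + base)]).
    by move=> t/=; rewrite in_itv/= => /seg[].
  by rewrite quotient_filter_in_comp_line; exact: df.
by move=> s /seg[].
Qed.

(** Continuity bounds all partial derivatives by one constant near p. Moving from p to q one
    coordinate at a time turns this into a Lipschitz estimate, provided that the intermediate points
    stay in the slab. *)
Lemma C1_slab_continuous (a b : R) f :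
  C1_on (slab a b) f -> {within slab a b, continuous f}.
Proof.
move=> C1f; apply/subspace_continuousP => p Dp.
(* The sum dominates each 1 + |partial derivative at p|, hence each partial derivative at points so
   close to p that it has changed by less than 1. *)
pose C := \sum_(i < n.+1) (1 + `|partial (slab a b) f i p|).
have C0 i : 1 + `|partial (slab a b) f i p| <= C.
  rewrite /C (bigD1 i)//= lerDl sumr_ge0// => j _; rewrite addr_ge0//.
have C1 : 1 <= C by rewrite (le_trans _ (C0 ord0))// lerDl.
have /nbhs_ballP[r /= r0 Hr] : \forall q \near within (slab a b) (nbhs p),
    forall i, `|partial (slab a b) f i q| <= C.
  apply: filter_forall => i; have [_ /subspace_continuousP/(_ _ Dp)] := C1f i.
  move=> /cvgrPdist_lt/(_ _ ltr01); apply: filterS => q H.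
  rewrite (le_trans _ (C0 i))// -[X in `|X|](subrK (partial (slab a b) f i p)).
  by rewrite (le_trans (ler_normD _ _))// lerD2r ltW// distrC.
apply/cvgrPdist_lt => e e0.
(* The path below has n + 1 steps, each allowed to contribute e / (n + 1). *)
pose d := Num.min r (e / (C * n.+1%:R)).
have nC : 0 < C * n.+1%:R by rewrite mulr_gt0// (lt_le_trans ltr01).
have d0 : 0 < d by rewrite lt_min r0 divr_gt0.
apply/nbhs_ballP; exists d => //= q pq Dq; change (`|f p - f q| < e).
(* The first k coordinates come from q and the others from p, so consecutive points differ in
   coordinate k only. *)
pose h (k : nat) : 'rV[R]_n.+1 := \row_j (if (j < k)%N then q 0 j else p 0 j).
have -> : f p = f (h 0) by congr f; apply/rowP => j; rewrite mxE.
have -> : f q = f (h n.+1) by congr f; apply/rowP => j; rewrite mxE ltn_ord.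
have pqj j : `|p 0 j - q 0 j| < d by have := pq.2 0 j.
rewrite distrC -(telescope_sumr (f \o h))// big_mkord.
rewrite (le_lt_trans (ler_norm_sum _ _ _))//.
have step (k : 'I_n.+1) : `|f (h k.+1) - f (h k)| < e / n.+1%:R.
  have hk : h k 0 k = p 0 k by rewrite mxE ltnn.
  have hk1 : h k.+1 0 k = q 0 k by rewrite mxE ltnSn.
  apply: (@le_lt_trans _ _ (C * `|h k.+1 0 k - h k 0 k|)).
    apply: (@partial_mean_value (slab a b)) => [j jk|z zh zk].
      by move: jk; rewrite !mxE ltnS (leq_eqVlt j) -val_eqE => /negPf ->.
    (* Only coordinate 0 is constrained, and to an interval; for z it lies between those of p and
       q. *)
    have Dz : slab a b z.
      rewrite /slab/=; have [k0|k0] := eqVneq (0 : 'I_n.+1) k.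
        move: zk Dp Dq; rewrite -!k0 /slab/= !mxE/=.
        by case: (leP (p 0 0) (q 0 0)) => _; lra.
      by rewrite zh// mxE; case: ifP.
    have pz : ball p r z.
      split => //= i j; rewrite (ord1 i) {i}.
      have pqr : `|p 0 j - q 0 j| < r by rewrite (lt_le_trans (pqj j))// ge_min lexx.
      have [jk|jk] := eqVneq j k.
        move: zk pqr; rewrite hk hk1 -jk /ball/= => /andP[z1 z2].
        case: (leP (p 0 j) (q 0 j)) z1 z2 => pq1 z1 z2.
          rewrite distrC (distrC (p 0 j)) !ger0_norm ?subr_ge0//; lra.
        rewrite !ger0_norm ?subr_ge0//; lra.
      rewrite zh// mxE; case: ifP => // _; exact: ballxx.
    split => //; [exact: (C1f k).1|exact: Hr].
  rewrite hk hk1 distrC -ltr_pdivlMl ?(lt_le_trans ltr01)//.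
  by rewrite (lt_le_trans (pqj k))// ge_min orbC invfM mulrCA mulrC lexx.
apply: (@lt_le_trans _ _ (\sum_(i < n.+1) e / n.+1%:R)).
  apply: ltr_sum => [|k _]; last exact: step.
  by apply/hasP; exists ord0; rewrite ?mem_index_enum.
by rewrite sumr_const card_ord -[X in X <= _]mulr_natr divfK.
Qed.

End C1_slab.

(** * Integrals of powers *)

Section improper_FTC2.
Context {R : realType}.
Notation mu := (@lebesgue_measure R).
Implicit Types (f F : R -> R) (a b : R).

Lemma cvg_within_seq (A : set R) F (u : nat -> R) (l : R) :
  F @ within A (nbhs l) --> F l -> (forall n, A (u n)) -> u n @[n --> \oo] --> l ->
  F (u n) @[n --> \oo] --> F l.
Proof.
move=> cF Au ul; apply: cvg_trans cF => P /= FP.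
have H : \forall n \near \oo, A (u n) -> P (F (u n)) := ul _ FP.
change (\forall n \near \oo, P (F (u n))).
by apply: filterS H => n; apply; exact: Au.
Qed.

(* The integrand may blow up at both ends, so the integral is exhausted from
   the inside by compact intervals. *)
Lemma ge0_FTC2_oo f F a b : a < b ->
  (forall x, a < x < b -> 0 <= f x) ->
  (forall x, a < x < b -> {for x, continuous f}) ->
  (forall x, a < x < b -> is_derive x 1 F (f x)) ->
  {within `[a, b], continuous F} ->
  (\int[mu]_(x in `[a, b]) (f x)%:E = (F b - F a)%:E)%E.
Proof.
move=> ab f0 cf dF cF.
have dF1 x : a < x < b -> derivable F x 1 by move=> /dF[].
have cF1 x : a < x < b -> {for x, continuous F}.
  by move=> /dF1 ?; apply: differentiable_continuous; exact/derivable1_diffP.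
(* The factor 1/3 keeps a + u n below b - u n for every n. *)
pose u n : R := (b - a) / 3 * harmonic n.
have u0 n : 0 < u n by rewrite mulr_gt0// ?divr_gt0 ?subr_gt0 ?harmonic_gt0.
have ab3 : 0 <= (b - a) / 3 by rewrite divr_ge0// subr_ge0 ltW.
have u3 n : u n <= (b - a) / 3.
  by rewrite ler_piMr// /harmonic/= invf_le1 ?ler1n.
have uhomo m n : (m <= n)%N -> u n <= u m.
  move=> mn; rewrite ler_wpM2l//.
  by rewrite /harmonic/= lef_pV2 ?posrE// ler_nat.
have ucvg : u n @[n --> \oo] --> (0 : R).
  by rewrite -(mulr0 ((b - a) / 3)); apply: cvgMr; exact: cvg_harmonic.
pose S n : set R := [set` `[a + u n, b - u n]].
have Soo n x : S n x -> a < x < b.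
  by rewrite /S/= in_itv/=; have := u0 n; lra.
have mf : measurable_fun `]a, b[ f.
  apply: open_continuous_measurable_fun => // x.
  by rewrite inE/= in_itv; exact: cf.
have SU : \bigcup_n S n = `]a, b[%classic.
  apply/seteqP; split => [x [n _ /Soo]|x]; first by rewrite /= in_itv.
  rewrite /= in_itv/= => /andP[ax xb].
  move/cvgrPdist_lt : (ucvg) => /(_ (Num.min (x - a) (b - x))).
  rewrite lt_min !subr_gt0 ax xb => /(_ isT)[N _ /(_ N (leqnn _))].
  rewrite /= sub0r normrN (gtr0_norm (u0 N)) lt_min => /andP[h1 h2].
  by exists N => //; rewrite /S/= in_itv/=; lra.
have FTCn n : (\int[mu]_(x in S n) (f x)%:E = (F (b - u n) - F (a + u n))%:E)%E.
  rewrite (@continuous_FTC2 _ f F)//.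
  - by have := u3 n; have := u0 n; lra.
  - apply: continuous_in_subspaceT => x; rewrite inE => /Soo; exact: cf.
  - have un3 := u3 n; have un0 := u0 n; split.
    + by move=> x; rewrite in_itv/= => xab; apply: dF1; lra.
    + by apply: cvg_at_right_filter; apply: cF1; lra.
    + by apply: cvg_at_left_filter; apply: cF1; lra.
  - move=> x; rewrite in_itv/= => xab; rewrite derive1E.
    by have [|_ ->] := dF x => //; have := u0 n; lra.
have inab n : `[a, b]%classic (a + u n) /\ `[a, b]%classic (b - u n).
  by rewrite /= !in_itv/=; have := u0 n; have := u3 n; lra.
have cvg1 : F (b - u n) - F (a + u n) @[n --> \oo] --> F b - F a.
  move/subspace_continuousP : cF => cF.
  apply: cvgB; apply: (cvg_within_seq (A := `[a, b]%classic)).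
  - by apply: cF; rewrite /= in_itv/= lexx ltW.
  - by move=> n; case: (inab n).
  - by rewrite -[X in _ --> X]subr0; apply: cvgB => //; exact: cvg_cst.
  - by apply: cF; rewrite /= in_itv/= lexx ltW.
  - by move=> n; case: (inab n).
  - by rewrite -[X in _ --> X]addr0; apply: cvgD => //; exact: cvg_cst.
have cvg2 : (\int[mu]_(x in S n) (f x)%:E)%E @[n --> \oo]
    --> (\int[mu]_(x in `]a, b[) (f x)%:E)%E.
  rewrite -SU; apply: ge0_nondecreasing_set_cvg_integral => //.
  - apply/nondecreasing_seqP => n; rewrite subsetEset => x.
    by rewrite /S/= !in_itv/=; have := uhomo _ _ (leqnSn n); lra.
  - by move=> n; exact: measurable_itv.
  - move=> n; apply/measurable_EFinP; apply: measurable_funS mf => //.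
    by move=> x /Soo; rewrite /= in_itv.
  - by move=> n x /Soo /f0; rewrite lee_fin.
rewrite integral_itv_bndoo; last exact/measurable_EFinP.
apply: (cvg_unique _ cvg2) => //.
rewrite (_ : (fun n => _) = fun n => (F (b - u n) - F (a + u n))%:E); last exact/funext.
by apply: cvg_EFin; [exact: nearW|exact: cvg1].
Qed.

End improper_FTC2.

(** * Continuity, primitives and integrals of powers *)

Section power_kernel.
Context {R : realType}.
Notation mu := (@lebesgue_measure R).
Implicit Types (f : R -> R) (p q x c d : R).

(** The absolute value gives continuity on the whole line, also across 0; [ge0_powR_continuous]
    removes it where the base is nonnegative. *)
Lemma normr_powR_continuous q : 0 < q -> continuous (fun t : R => `|t| `^ q).
Proof.
move=> q0 t; have [->|t0] := eqVneq t 0.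
  apply/cvgrPdist_lt => e e0; near=> s.
  rewrite normr0 powR0 ?gt_eqF// sub0r normrN ger0_norm ?powR_ge0//.
  have -> : e = (e `^ q^-1) `^ q by rewrite -powRrM mulVf ?gt_eqF// powRr1 ?ltW.
  rewrite gt0_ltr_powR ?nnegrE ?powR_ge0//.
  near: s; apply/nbhs_ballP; exists (e `^ q^-1) => /=; first by rewrite powR_gt0.
  by move=> s; rewrite /ball/= sub0r normrN.
apply: (@continuous_comp _ _ _ _ (fun s => s `^ q)); first exact: norm_continuous.
apply: differentiable_continuous; apply/derivable1_diffP.
by apply: derivable_powR; rewrite in_itv/= normr_gt0 t0.
Unshelve. all: by end_near. Qed.

Lemma ge0_powR_continuous q (A : set R) (g : R -> R) : 0 < q ->
  continuous g -> (forall t, A t -> 0 <= g t) ->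
  {within A, continuous (fun t => g t `^ q)}.
Proof.
move=> q0 cg g0; apply: (@subspace_eq_continuous _ _ _ (fun t => `|g t| `^ q)).
  by move=> t; rewrite inE => /g0 gt; rewrite ger0_norm.
apply: continuous_subspaceT => t.
apply: (@continuous_comp _ _ _ g (fun s => `|s| `^ q)); first exact: cg.
exact: normr_powR_continuous.
Qed.

Lemma is_derive_powR_primitive p (g : R -> R) (t e : R) : -1 < p -> 0 < g t ->
  is_derive t 1 g e ->
  is_derive t 1 (fun s => g s `^ (p + 1) / (p + 1)) (e * g t `^ p).
Proof.
move=> p1 gt0 dg; have p0 : p + 1 != 0 by rewrite gt_eqF//; lra.
have dgp := is_derive1_comp (is_derive1_powR (p + 1) gt0) dg.
have : is_derive t 1 ((p + 1)^-1 \*: ((fun s => s `^ (p + 1)) \o g))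
    ((p + 1)^-1 *: ((p + 1) * g t `^ (p + 1 - 1) * e)) by exact: is_deriveZ.
rewrite addrK.
have -> : (p + 1)^-1 *: ((p + 1) * g t `^ p * e) = e * g t `^ p.
  by rewrite /GRing.scale/= -mulrA mulKf// mulrC.
suff -> : (p + 1)^-1 \*: ((fun s => s `^ (p + 1)) \o g) =
  (fun s => g s `^ (p + 1) / (p + 1)) by [].
by apply/funext => s; rewrite /GRing.scale/= mulrC.
Qed.

Lemma gt0_powR_continuous p (g : R -> R) t : 0 < g t -> {for t, continuous g} ->
  {for t, continuous (fun s => g s `^ p)}.
Proof.
move=> gt0 cg; apply: (@continuous_comp _ _ _ g (fun s => s `^ p)) => //.
apply: differentiable_continuous; apply/derivable1_diffP.
by apply: derivable_powR; rewrite in_itv/= andbT.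
Qed.

(** For p < 0 and c = x the integrand is singular at t = x. Since p + 1 > 0 the primitive is still
    continuous there, which is all that [ge0_FTC2_oo] asks at an endpoint. *)
Lemma integral_powR_right p x c d : -1 < p -> x <= c -> c <= d ->
  (\int[mu]_(t in `[c, d]) ((t - x) `^ p)%:E =
   ((d - x) `^ (p + 1) / (p + 1) - (c - x) `^ (p + 1) / (p + 1))%:E)%E.
Proof.
move=> p1 xc; have p10 : 0 < p + 1 by lra.
rewrite le_eqVlt => /predU1P[->|cd].
  by rewrite set_itv1 integral_set1 subrr.
have cg : continuous (fun t : R => t - x).
  by move=> t; apply: cvgB => //; exact: cvg_cst.
apply: (ge0_FTC2_oo (F := fun t => (t - x) `^ (p + 1) / (p + 1)) cd).
- by move=> t _; exact: powR_ge0.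
- by move=> t ctd; apply: gt0_powR_continuous; [lra|exact: cg].
- move=> t ctd; rewrite -[X in is_derive _ _ _ X]mul1r.
  apply: is_derive_powR_primitive => //; first lra.
  by apply: is_derive_eq; rewrite subr0.
- apply/subspace_continuousP => t ctd; apply: cvgMl.
  apply: (subspace_continuousP _ _).1 t ctd; apply: ge0_powR_continuous => // t.
  by rewrite /= in_itv/=; lra.
Qed.

Lemma integral_powR_left p x c d : -1 < p -> c <= d -> d <= x ->
  (\int[mu]_(t in `[c, d]) ((x - t) `^ p)%:E =
   ((x - c) `^ (p + 1) / (p + 1) - (x - d) `^ (p + 1) / (p + 1))%:E)%E.
Proof.
move=> p1 + dx; have p10 : 0 < p + 1 by lra.
rewrite le_eqVlt => /predU1P[->|cd].
  by rewrite set_itv1 integral_set1 subrr.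
have cg : continuous (fun t : R => x - t).
  by move=> t; apply: cvgB => //; exact: cvg_cst.
rewrite [RHS](_ : _ = (- ((x - d) `^ (p + 1) / (p + 1))
                       - - ((x - c) `^ (p + 1) / (p + 1)))%:E); last first.
  by rewrite opprK addrC.
apply: (ge0_FTC2_oo (F := fun t => - ((x - t) `^ (p + 1) / (p + 1))) cd).
- by move=> t _; exact: powR_ge0.
- by move=> t ctd; apply: gt0_powR_continuous; [lra|exact: cg].
- move=> t ctd; rewrite (_ : (x - t) `^ p = - (-1 * (x - t) `^ p)); last first.
    by rewrite mulN1r opprK.
  apply: (is_deriveN (f := fun t => (x - t) `^ (p + 1) / (p + 1))).
  apply: is_derive_powR_primitive => //; first lra.
  by apply: is_derive_eq; rewrite add0r mul1r.
- apply/subspace_continuousP => t ctd; apply: cvgN; apply: cvgMl.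
  apply: (subspace_continuousP _ _).1 t ctd; apply: ge0_powR_continuous => // t.
  by rewrite /= in_itv/=; lra.
Qed.

End power_kernel.

(** * Integrals against a power kernel *)

Section power_integrals.
Context {R : realType}.
Notation mu := (@lebesgue_measure R).
Implicit Types (f g : R -> R) (a b p x c d M : R).

(* With p = - alpha these are the integrals in [right_kernel] and [left_Caputo];
   with p = beta - 1 those in [right_integral] and [left_integral]. *)
Definition right_power_integral p c f x : R :=
  \int[mu]_(t in `[x, c]) ((t - x) `^ p * f t).

Definition left_power_integral p a f x : R :=
  \int[mu]_(t in `[a, x]) ((x - t) `^ p * f t).

Lemma within_continuous_bounded a b f : {within `[a, b], continuous f} ->
  exists2 M, 0 <= M & forall x, a <= x <= b -> `|f x| <= M.
Proof.
move=> cf; have [M [_ Mf]] := compact_bounded (continuous_compact cf (segment_compact (a:=a) (b:=b))).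
exists (`|M| + 1) => [|x xab]; first by rewrite addr_ge0.
apply: Mf; first by rewrite ltr_pwDr// ler_norm.
by exists x => //=; rewrite in_itv.
Qed.

Lemma within_continuous_integrable a b f : {within `[a, b], continuous f} ->
  mu.-integrable `[a, b] (EFin \o f).
Proof. by move=> cf; apply: continuous_compact_integrable => //; exact: segment_compact. Qed.

Lemma within_continuous_measurable a b f : {within `[a, b], continuous f} ->
  measurable_fun `[a, b] f.
Proof. by move=> cf; apply: subspace_continuous_measurable_fun. Qed.

Lemma measurable_powR_comp (D : set R) p (g : R -> R) : measurable_fun D g ->
  measurable_fun D (fun t => g t `^ p).
Proof.
by move=> mg; apply: (measurableT_comp (f := fun s => s `^ p)) mg; exact: measurable_powR.
Qed.

Lemma integrable_powR_right p x c d : -1 < p -> x <= c -> c <= d ->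
  mu.-integrable `[c, d] (EFin \o (fun t => (t - x) `^ p)).
Proof.
move=> p1 xc cd; apply/integrableP; split.
  by apply/measurable_EFinP; apply: measurable_powR_comp; exact: measurable_funB.
under eq_integral do rewrite /= ger0_norm ?powR_ge0//.
by rewrite integral_powR_right// ltry.
Qed.

Lemma integrable_powR_left p x c d : -1 < p -> c <= d -> d <= x ->
  mu.-integrable `[c, d] (EFin \o (fun t => (x - t) `^ p)).
Proof.
move=> p1 cd dx; apply/integrableP; split.
  by apply/measurable_EFinP; apply: measurable_powR_comp; exact: measurable_funB.
under eq_integral do rewrite /= ger0_norm ?powR_ge0//.
by rewrite integral_powR_left// ltry.
Qed.

Lemma integrable_mul_within_continuous c d (k f : R -> R) :
  mu.-integrable `[c, d] (EFin \o k) -> {within `[c, d], continuous f} ->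
  mu.-integrable `[c, d] (EFin \o (fun t => k t * f t)).
Proof.
move=> ik cf; have [M M0 Mf] := within_continuous_bounded cf.
apply: (@integrableMl _ _ _ mu _ _ (EFin \o k) f) => //.
  exact: within_continuous_measurable.
exists M; split => [|m Mm t /=]; first exact: num_real.
rewrite in_itv/= => /Mf /le_trans; apply.
exact: ltW.
Qed.

Lemma integrable_right_power p x c d f : -1 < p -> x <= c -> c <= d ->
  {within `[c, d], continuous f} ->
  mu.-integrable `[c, d] (EFin \o (fun t => (t - x) `^ p * f t)).
Proof.
by move=> p1 xc cd; apply: integrable_mul_within_continuous; exact: integrable_powR_right.
Qed.

Lemma integrable_left_power p x c d f : -1 < p -> c <= d -> d <= x ->
  {within `[c, d], continuous f} ->
  mu.-integrable `[c, d] (EFin \o (fun t => (x - t) `^ p * f t)).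
Proof.
by move=> p1 cd dx; apply: integrable_mul_within_continuous; exact: integrable_powR_left.
Qed.

Lemma within_continuous_itvS a b c d f : a <= c -> d <= b ->
  {within `[a, b], continuous f} -> {within `[c, d], continuous f}.
Proof.
move=> ac db; apply: continuous_subspaceW => t /=; rewrite !in_itv/=; lra.
Qed.

(** Condition (ii) writes each right operator as a part up to b - tau plus a tail over [b - tau, b];
    with c = b - tau the operator with endpoint b is reassembled. The same splitting isolates the
    short piece [x, y] in the modulus of continuity below. *)
Lemma right_power_integral_split p x c d f : -1 < p -> x <= c -> c <= d ->
  {within `[x, d], continuous f} ->
  right_power_integral p d f x = right_power_integral p c f x
    + \int[mu]_(t in `[c, d]) ((t - x) `^ p * f t).
Proof.
move=> p1 xc cd cf; have xd := le_trans xc cd.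
have ixd := integrable_right_power p1 (lexx x) xd cf.
have icd : mu.-integrable `]c, d] (EFin \o (fun t => (t - x) `^ p * f t)).
  by apply: integrableS ixd => // t /=; rewrite !in_itv/=; lra.
rewrite -Rintegral_itv_obnd_cbnd// -(Rintegral_itvB ixd) ?bnd_simp//.
by rewrite addrC subrK.
Qed.

End power_integrals.

(** * Continuity of right power integrals in the lower limit *)

Section power_integrals_continuity.
Context {R : realType}.
Notation mu := (@lebesgue_measure R).
Implicit Types (f g : R -> R) (a b p x y c d M : R).

Lemma integrable_itv_oc c d (f : R -> \bar R) :
  mu.-integrable `[c, d] f -> mu.-integrable `]c, d] f.
Proof. by apply: integrableS => // t /=; rewrite !in_itv/=; lra. Qed.

Lemma integrable_mulrl (D : set R) k f : measurable D ->
  mu.-integrable D (EFin \o f) -> mu.-integrable D (EFin \o (fun t => k * f t)).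
Proof. by move=> mD fi; have H := integrableZl _ k fi; apply: eq_integrable (H mD). Qed.

Lemma integrable_subr (D : set R) f g : measurable D ->
  mu.-integrable D (EFin \o f) -> mu.-integrable D (EFin \o g) ->
  mu.-integrable D (EFin \o (fun t => f t - g t)).
Proof. by move=> mD fi gi; have H := integrableB _ fi gi; apply: eq_integrable (H mD). Qed.

(** For s >= 0 this is the primitive of s^p vanishing at 0. The absolute value extends it to an even
    continuous function, which makes the modulus below symmetric in x and y. *)
Definition power_primitive p (s : R) : R := `|s| `^ (p + 1) / (p + 1).

(** A power is monotone in its base, in a direction given by the sign of p. The point t = y is
    excluded because 0^p has the default value 0 for p < 0; the integrals below are accordingly
    taken over ]y, b]. *)
Lemma le_powR_shift p x y t : x <= y -> y < t ->
  if 0 <= p then (t - y) `^ p <= (t - x) `^ p else (t - x) `^ p <= (t - y) `^ p.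
Proof.
move=> xy yt; have ty : t - y <= t - x by lra.
case: ifPn => [p0|]; first by rewrite ge0_ler_powR// nnegrE; lra.
rewrite -ltNge => p0; rewrite -(opprK p) !(powRN _ (- p)).
rewrite lef_pV2 ?posrE ?powR_gt0; try lra.
by rewrite ge0_ler_powR// ?nnegrE; lra.
Qed.

(* For x <= y the difference (t - x)^p - (t - y)^p has a constant sign on
   ]y, b], so its absolute value is integrated explicitly. *)
Lemma right_power_integral_modulus p b f M x y : -1 < p ->
  x <= y <= b -> {within `[x, b], continuous f} ->
  (forall t, x <= t <= b -> `|f t| <= M) ->
  `|right_power_integral p b f x - right_power_integral p b f y|
    <= M * (2 * power_primitive p (x - y)
            + `|power_primitive p (b - x) - power_primitive p (b - y)|).
Proof.
move=> p1 /andP[xy yb] cf Mf; have p10 : 0 < p + 1 by lra.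
pose K := power_primitive p.
have M0 : 0 <= M by rewrite (le_trans _ (Mf x _))// lexx (le_trans xy).
have K0 s : 0 <= K s by rewrite divr_ge0 ?powR_ge0// ltW.
have KE s : 0 <= s -> K s = s `^ (p + 1) / (p + 1) by move=> s0; rewrite /K /power_primitive ger0_norm.
have cfy := within_continuous_itvS xy (lexx b) cf.
have cfx := within_continuous_itvS (lexx x) yb cf.
pose k1 t := (t - x) `^ p; pose k2 t := (t - y) `^ p.
have i1 : mu.-integrable `]y, b] (EFin \o k1).
  exact: integrable_itv_oc (integrable_powR_right p1 xy yb).
have i2 : mu.-integrable `]y, b] (EFin \o k2).
  exact: integrable_itv_oc (integrable_powR_right p1 (lexx y) yb).
have i1f : mu.-integrable `]y, b] (EFin \o (fun t => k1 t * f t)).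
  exact: integrable_itv_oc (integrable_right_power p1 xy yb cfy).
have i2f : mu.-integrable `]y, b] (EFin \o (fun t => k2 t * f t)).
  exact: integrable_itv_oc (integrable_right_power p1 (lexx y) yb cfy).
rewrite (right_power_integral_split p1 xy yb cf) [right_power_integral p b f y]/right_power_integral.
rewrite -!Rintegral_itv_obnd_cbnd// -addrA -RintegralB//.
have I1 : \int[mu]_(t in `]y, b]) k1 t = K (b - x) - K (y - x).
  rewrite Rintegral_itv_obnd_cbnd// /Rintegral integral_powR_right//= !KE//; lra.
have I2 : \int[mu]_(t in `]y, b]) k2 t = K (b - y).
  rewrite Rintegral_itv_obnd_cbnd// /Rintegral integral_powR_right//= KE ?subr_ge0//.
  by rewrite subrr powR0 ?gt_eqF// mul0r subr0.
have A1 : `|right_power_integral p y f x| <= M * K (x - y).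
  apply: (le_trans (le_normr_Rintegral _ (integrable_right_power p1 (lexx x) xy cfx))) => //.
  have -> : M * K (x - y) = \int[mu]_(t in `[x, y]) (M * (t - x) `^ p).
    rewrite RintegralZl//; last exact: integrable_powR_right.
    rewrite /Rintegral integral_powR_right//= subrr powR0 ?gt_eqF// mul0r subr0.
    by rewrite /K /power_primitive distrC ger0_norm ?subr_ge0.
  apply: le_Rintegral => //.
  - by apply: integrable_norm => //; exact: integrable_right_power.
  - by apply: integrable_mulrl => //; exact: integrable_powR_right.
  - move=> t /=; rewrite in_itv/= => xty; rewrite normrM ger0_norm ?powR_ge0// mulrC.
    by rewrite ler_wpM2r ?powR_ge0// Mf//; lra.
have A2 : `|\int[mu]_(t in `]y, b]) (k1 t * f t - k2 t * f t)|
    <= M * `|K (b - x) - K (y - x) - K (b - y)|.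
  have i12 : mu.-integrable `]y, b] (EFin \o (fun t => k1 t - k2 t)) by exact: integrable_subr.
  have i12f : mu.-integrable `]y, b] (EFin \o (fun t => k1 t * f t - k2 t * f t)).
    exact: integrable_subr.
  apply: (le_trans (le_normr_Rintegral _ i12f)) => //.
  have -> : `|K (b - x) - K (y - x) - K (b - y)| = \int[mu]_(t in `]y, b]) `|k1 t - k2 t|.
    rewrite -I1 -I2 -RintegralB//.
    have := fun t => @le_powR_shift p x y t xy; case: (leP 0 p) => _ sgn.
      rewrite ger0_norm; last first.
        apply: Rintegral_ge0 => t /=; rewrite in_itv/= => /andP[yt _].
        by rewrite subr_ge0; exact: sgn.
      apply: eq_Rintegral => t; rewrite inE/= in_itv/= => /andP[yt _].
      by rewrite ger0_norm ?subr_ge0//; exact: sgn.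
    rewrite -normrN -mulN1r -RintegralZl//.
    rewrite ger0_norm; last first.
      apply: Rintegral_ge0 => t /=; rewrite in_itv/= => /andP[yt _].
      by rewrite mulN1r opprB subr_ge0; exact: sgn.
    apply: eq_Rintegral => t; rewrite inE/= in_itv/= => /andP[yt _].
    by rewrite mulN1r ler0_norm ?subr_le0//; exact: sgn.
  rewrite -RintegralZl//; last exact: integrable_norm.
  apply: le_Rintegral => //.
  - exact: integrable_norm.
  - by apply: integrable_mulrl => //; exact: integrable_norm.
  - move=> t /=; rewrite in_itv/= => xty; rewrite -mulrBl normrM mulrC.
    by rewrite ler_wpM2r// Mf//; lra.
apply: (le_trans (ler_normD _ _)); apply: (le_trans (lerD A1 A2)).
rewrite -mulrDr ler_wpM2l// -/K.
have KN : K (y - x) = K (x - y) by rewrite /K /power_primitive distrC.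
(* [K (y - x)] occurs twice: from the piece [x, y], and as the lower endpoint term of the integral
   of (t - x)^p over ]y, b]. This is the factor 2. *)
have := ler_normB (K (b - x) - K (b - y)) (K (y - x)).
rewrite (ger0_norm (K0 (y - x))) KN [K (b - x) - K (b - y) - _]addrAC; lra.
Qed.

(** The modulus [W x y] is continuous in y and vanishes at y = x; by its symmetry the estimate for x
    <= y covers y on both sides of x. *)
Lemma right_power_integral_continuous p a b f : -1 < p ->
  {within `[a, b], continuous f} ->
  {within `[a, b], continuous (right_power_integral p b f)}.
Proof.
move=> p1 cf; have [M M0 Mf] := within_continuous_bounded cf.
have p10 : 0 < p + 1 by lra.
pose W x y := M * (2 * power_primitive p (x - y)
            + `|power_primitive p (b - x) - power_primitive p (b - y)|).
have modW x y : a <= x -> x <= y -> y <= b ->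
    `|right_power_integral p b f x - right_power_integral p b f y| <= W x y.
  move=> ax xy yb; apply: right_power_integral_modulus => //.
  - by rewrite xy.
  - exact: within_continuous_itvS cf.
  - by move=> t xt; apply: Mf; lra.
have cK : continuous (power_primitive p).
  by move=> s; apply: cvgMl; exact: normr_powR_continuous.
apply/subspace_continuousP => x /=; rewrite in_itv/= => /andP[ax xb].
have W0 : W x y @[y --> within `[a, b] (nbhs x)] --> 0.
  have -> : 0 = W x x.
    by rewrite /W !subrr normr0 /power_primitive normr0 powR0 ?gt_eqF// mul0r !mulr0 addr0 mulr0.
  have cKB c : {for x, continuous (fun y => power_primitive p (c - y))}.
    apply: (@continuous_comp _ _ _ (fun y => c - y) (power_primitive p)); last exact: cK.
    by apply: cvgB => //; exact: cvg_cst.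
  apply: cvg_within_filter; apply: cvgMr; apply: cvgD.
    by apply: cvgMr; exact: cKB.
  by apply: cvg_norm; apply: cvgB; [exact: cvg_cst|exact: cKB].
have WC y : W x y = W y x.
  by rewrite /W {1}/power_primitive distrC -/(power_primitive p (y - x)) distrC.
apply/cvgrPdist_lt => e e0.
move/cvgrPdist_lt : W0 => /(_ e e0); rewrite !near_withinE.
apply: filterS => y Wy /[dup] yab /Wy; rewrite sub0r normrN => {}Wy.
apply: le_lt_trans (le_lt_trans (ler_norm _) Wy).
move: yab; rewrite /= in_itv/= => /andP[ay yb].
have [xy|/ltW yx] := leP x y; first exact: modW.
by rewrite distrC WC; exact: modW.
Qed.

End power_integrals_continuity.

(** * Duality of left and right power integrals *)

Section power_integrals_fubini.
Context {R : realType}.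
Notation mu := (@lebesgue_measure R).
Implicit Types (f g : R -> R) (a b p x y c d M : R).

(** With z = (x, t), the triangle t <= x is encoded in the integrand, so that Fubini's theorem is
    applied on the whole plane. *)
Let kernel p f g (z : R * R) : R :=
  f z.1 * (if z.2 <= z.1 then (z.1 - z.2) `^ p else 0) * g z.2.

Let measurable_kernel p f g : measurable_fun setT f -> measurable_fun setT g ->
  measurable_fun setT (kernel p f g).
Proof.
move=> mf mg; apply: measurable_funM; last exact: measurableT_comp.
apply: measurable_funM; first exact: measurableT_comp.
apply: measurable_fun_ifT => //.
  exact: measurable_fun_ler.
apply: (measurableT_comp (f := fun s => s `^ p)); first exact: measurable_powR.
exact: measurable_funB.
Qed.

(** Fractional integration by parts without Gamma factors: both sides are iterated integrals of f(x)
    (x - t)^p g(t) over the triangle a <= t <= x <= b. Absolute integrability there comes from the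
    boundedness of f and g and from p > -1. *)
Lemma power_integral_duality p a b f g : -1 < p ->
  {within `[a, b], continuous f} -> {within `[a, b], continuous g} ->
  \int[mu]_(x in `[a, b]) (f x * left_power_integral p a g x) =
  \int[mu]_(t in `[a, b]) (right_power_integral p b f t * g t).
Proof.
move=> p1 cf cg.
have [M M0 Mf] := within_continuous_bounded cf.
have [N N0 Ng] := within_continuous_bounded cg.
pose fp := f \_ `[a, b]; pose gp := g \_ `[a, b].
have mfp : measurable_fun setT fp.
  by apply/(measurable_restrictT f) => //; exact: within_continuous_measurable.
have mgp : measurable_fun setT gp.
  by apply/(measurable_restrictT g) => //; exact: within_continuous_measurable.
pose h := kernel p fp gp.
have mh : measurable_fun setT (EFin \o h) by apply/measurable_EFinP; exact: measurable_kernel.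
have fpE x : fp x = if a <= x <= b then f x else 0.
  by rewrite /fp patchE mem_setE in_itv.
have gpE x : gp x = if a <= x <= b then g x else 0.
  by rewrite /gp patchE mem_setE in_itv.
have left_slice x : (\int[mu]_t (h (x, t))%:E)%E =
    (((fun x => f x * left_power_integral p a g x) \_ `[a, b]) x)%:E.
  rewrite patchE mem_setE in_itv/=; case: ifPn => xab; last first.
    by under eq_integral do rewrite /h /kernel/= fpE (negPf xab) !mul0r; rewrite integral0.
  have ax : a <= x by case/andP : xab.
  have cgx : {within `[a, x], continuous g}.
    by apply: within_continuous_itvS cg => //; case/andP : xab.
  have ig := integrable_left_power p1 ax (lexx x) cgx.
  rewrite -RintegralZl// /Rintegral fineK; last first.
    by apply: integrable_fin_num => //; exact: integrable_mulrl.
  rewrite [RHS]integral_mkcond; apply: eq_integral => t _.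
  rewrite patchE mem_setE in_itv/= /h /kernel/= fpE gpE xab.
  have [xt|tx] := leP t x; last by rewrite andbF mulr0 mul0r.
  have -> : (a <= t <= b) = (a <= t) by case/andP : xab; lra.
  by rewrite andbT; case: ifP => _; rewrite ?mulr0// mulrA.
have right_slice t : (\int[mu]_x (h (x, t))%:E)%E =
    (((fun t => right_power_integral p b f t * g t) \_ `[a, b]) t)%:E.
  rewrite patchE mem_setE in_itv/=; case: ifPn => tab; last first.
    by under eq_integral do rewrite /h /kernel/= gpE (negPf tab) !mulr0; rewrite integral0.
  have tb : t <= b by case/andP : tab.
  have cft : {within `[t, b], continuous f}.
    by apply: within_continuous_itvS cf => //; case/andP : tab.
  have iF := integrable_right_power p1 (lexx t) tb cft.
  rewrite mulrC -RintegralZl// /Rintegral fineK; last first.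
    by apply: integrable_fin_num => //; exact: integrable_mulrl.
  rewrite [RHS]integral_mkcond; apply: eq_integral => x _.
  rewrite patchE mem_setE in_itv/= /h /kernel/= fpE gpE tab.
  have [tx|xt] := leP t x; last by rewrite mulr0 mul0r.
  have -> : (a <= x <= b) = (x <= b) by case/andP : tab; lra.
  by case: ifP => _; rewrite ?mul0r ?mulr0// mulrC [f x * _]mulrC.
suff ih : (mu \x mu)%E.-integrable setT (EFin \o h).
  have := Fubini ih; rewrite /=.
  under eq_integral do rewrite left_slice.
  under [in RHS]eq_integral do rewrite right_slice.
  move=> H; rewrite Rintegral_mkcond [RHS]Rintegral_mkcond.
  exact: (congr1 fine H).
apply/integrable12ltyP => //.
(* M and N bound |f| and |g|; the last factor bounds the integral of (x - t)^p over t in [a, x], for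
   every x in [a, b]. *)
pose C := M * N * ((b - a) `^ (p + 1) / (p + 1)).
apply: (@le_lt_trans _ _ (\int[mu]_(x in `[a, b]) C%:E)%E); last first.
  rewrite integral_cst//= lebesgue_measure_itv/=; case: ifP => _.
    by rewrite -EFinD -EFinM ltry.
  by rewrite mule0 ltry.
rewrite [leRHS]integral_mkcond.
apply: ge0_le_integral => //.
- by move=> x _; exact: integral_ge0.
- apply: (@measurable_fun_fubini_tonelli_F _ _ _ _ R mu (abse \o (EFin \o h))).
    by apply: measurableT_comp => //; exact: measurable_abse.
  by move=> z; exact: abse_ge0.
- apply/(measurable_restrictT (cst C%:E)) => //.
move=> x _; rewrite patchE mem_setE in_itv/=; case: ifPn => xab; last first.
  under eq_integral do rewrite /h /kernel/= fpE (negPf xab) !mul0r normr0.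
  by rewrite integral0.
have ax : a <= x by case/andP : xab.
apply: (@le_trans _ _ (\int[mu]_(t in `[a, x]) (M * N * (x - t) `^ p)%:E)%E).
  rewrite [leRHS]integral_mkcond; apply: ge0_le_integral => //.
  - do 2 apply: measurableT_comp => //; apply/measurable_EFinP.
    exact: (measurable_fun_pair2 x mh).
  - apply: (iffLR (measurable_restrictT _ _)) => //.
    have H : measurable_fun `[a, x] (EFin \o (fun t => M * N * (x - t) `^ p)).
      apply/measurable_EFinP; apply: measurable_funM => //.
      by apply: measurable_powR_comp; exact: measurable_funB.
    exact: H.
  - move=> t _; rewrite patchE mem_setE in_itv/= /h /kernel/= fpE gpE xab.
    have [xt|tx] := leP t x; last by rewrite andbF mulr0 mul0r normr0.
    have -> : (a <= t <= b) = (a <= t) by case/andP : xab; lra.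
    rewrite andbT; case: ifP => tab; last by rewrite mulr0 normr0.
    rewrite lee_fin !normrM mulrAC (ger0_norm (powR_ge0 _ _)) ler_wpM2r ?powR_ge0//.
    by rewrite ler_pM// ?Mf// Ng// tab (le_trans xt)//; case/andP : xab.
under eq_integral do rewrite EFinM.
rewrite integralZl//; last exact: integrable_powR_left.
rewrite integral_powR_left// subrr powR0; last by rewrite gt_eqF//; lra.
rewrite mul0r subr0 -EFinM lee_fin ler_wpM2l ?mulr_ge0// ler_wpM2r//.
  by rewrite invr_ge0; lra.
by rewrite ge0_ler_powR// ?nnegrE; case/andP : xab; lra.
Qed.

End power_integrals_fubini.

(** * Integration by parts *)

Section integration_by_parts_within.
Context {R : realType}.
Notation mu := (@lebesgue_measure R).
Implicit Types (f g : R -> R) (a b c d tau u v : R).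

Lemma within_continuousM (D : set R) f g :
  {within D, continuous f} -> {within D, continuous g} ->
  {within D, continuous (fun x => f x * g x)}.
Proof.
move=> /subspace_continuousP cf /subspace_continuousP cg.
by apply/subspace_continuousP => x Dx; apply: cvgM; [exact: cf|exact: cg].
Qed.

Lemma within_continuousDr (D : set R) f g :
  {within D, continuous f} -> {within D, continuous g} ->
  {within D, continuous (fun x => f x + g x)}.
Proof. exact: within_continuousD. Qed.

Lemma within_continuousBr (D : set R) f g :
  {within D, continuous f} -> {within D, continuous g} ->
  {within D, continuous (fun x => f x - g x)}.
Proof. exact: within_continuousB. Qed.

Lemma within_continuous_cst_mul (D : set R) (k : R) f :
  {within D, continuous f} -> {within D, continuous (fun x => k * f x)}.
Proof.
by move=> cf; apply: within_continuousM => //; apply: continuous_subspaceT; exact: cst_continuous.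
Qed.

Lemma within_continuous_comp_shift a b tau f :
  {within `[a, b], continuous f} ->
  {within `[a - tau, b - tau], continuous (fun x => f (x + tau))}.
Proof.
move=> /subspace_continuousP cf; apply/subspace_continuousP => x /= xab.
have xtab : `[a, b]%classic (x + tau) by move: xab; rewrite /= !in_itv/=; lra.
apply: cvg_trans (cf _ xtab) => P /= fP.
have cs : (fun y => y + tau) @ (nbhs x) --> (x + tau).
  by apply: cvgD => //; exact: cvg_cst.
have H : \forall y \near x, `[a, b]%classic (y + tau) -> P (f (y + tau)) := cs _ fP.
change (\forall y \near x, `[a - tau, b - tau]%classic y -> P (f (y + tau))).
apply: filterS H => y Hy yab; apply: Hy.
by move: yab; rewrite /= !in_itv/=; lra.
Qed.

(** Converts derivatives within [u, v] into the form that [Rintegration_by_parts] takes: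
    derivability inside, one-sided continuity at the ends. *)
Lemma quotient_filter_in_LRcontinuous u v f (f' : R -> R) : u < v ->
  (forall x, u <= x <= v -> quotient_filter_in `[u, v] f x 1 --> f' x) ->
  derivable_oo_LRcontinuous f u v /\ {in `]u, v[, derive1 f =1 f'}.
Proof.
move=> uv df.
have dfi x : x \in `]u, v[ -> is_derive x 1 f (f' x).
  rewrite in_itv/= => uxv; apply: (quotient_filter_in_is_derive uxv).
  by apply: df; lra.
split; last by move=> x /dfi dfx; rewrite derive1E derive_val.
have cf : {within `[u, v], continuous f}.
  apply/subspace_continuousP => x /=; rewrite in_itv/= => uxv.
  exact: quotient_filter_in_continuous (df _ uxv).
have [_ fu fv] := (continuous_within_itvP _ uv).1 cf.
by split => // x /dfi[].
Qed.

Lemma integration_by_parts_within u v f g (f' g' : R -> R) : u < v ->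
  (forall x, u <= x <= v -> quotient_filter_in `[u, v] f x 1 --> f' x) ->
  (forall x, u <= x <= v -> quotient_filter_in `[u, v] g x 1 --> g' x) ->
  {within `[u, v], continuous f'} -> {within `[u, v], continuous g'} ->
  \int[mu]_(x in `[u, v]) (f' x * g x + f x * g' x) = f v * g v - f u * g u.
Proof.
move=> uv df dg cf' cg'.
have [fLR f'E] := quotient_filter_in_LRcontinuous uv df.
have [gLR g'E] := quotient_filter_in_LRcontinuous uv dg.
have cf := derivable_oo_LRcontinuous_within fLR.
have cg := derivable_oo_LRcontinuous_within gLR.
rewrite RintegralD//.
- by rewrite (Rintegration_by_parts uv cf' fLR f'E cg' gLR g'E) addrC subrK.
- by apply: within_continuous_integrable; exact: within_continuousM.
- by apply: within_continuous_integrable; exact: within_continuousM.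
Qed.

Lemma Rintegral_shift c d tau g : c <= d ->
  {within `[c + tau, d + tau], continuous g} ->
  \int[mu]_(x in `[c + tau, d + tau]) g x = \int[mu]_(x in `[c, d]) g (x + tau).
Proof.
move=> cd cg; rewrite /Rintegral.
have dE : derive1 (fun x : R => x + tau) = cst 1.
  by apply/funext => x; rewrite derive1E derive_val addr0.
rewrite (integration_by_substitution_increasing (F := fun x => x + tau) cd) ?dE//.
- by congr fine; apply: eq_integral => x _ /=; rewrite mulr1.
- by move=> x y _ _; rewrite ltrD2r.
- by move=> x _; exact: cvg_cst.
- exact: is_cvg_cst.
- exact: is_cvg_cst.
- split => //.
  + by apply: cvg_at_right_filter; apply: cvgD => //; exact: cvg_cst.
  + by apply: cvg_at_left_filter; apply: cvgD => //; exact: cvg_cst.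
Qed.

Lemma Rintegral_itv_split a b c f : a <= c <= b -> {within `[a, b], continuous f} ->
  \int[mu]_(x in `[a, b]) f x =
  \int[mu]_(x in `[a, c]) f x + \int[mu]_(x in `[c, b]) f x.
Proof.
move=> /andP[ac cb] cf; have iab := within_continuous_integrable cf.
rewrite -(@Rintegral_itv_obnd_cbnd _ c); last first.
  exact/integrable_itv_oc/within_continuous_integrable/(within_continuous_itvS ac (lexx b)).
by rewrite -(Rintegral_itvB iab) ?bnd_simp// addrC subrK.
Qed.

End integration_by_parts_within.

(** * Vanishing of the linearized functional *)

Section weak_Euler_Lagrange.
Context {R : realType}.
Notation mu := (@lebesgue_measure R).

Lemma Rintegral_within_continuousD a b (f g : R -> R) :
  {within `[a, b], continuous f} -> {within `[a, b], continuous g} ->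
  \int[mu]_(x in `[a, b]) (f x + g x) =
  \int[mu]_(x in `[a, b]) f x + \int[mu]_(x in `[a, b]) g x.
Proof. by move=> cf cg; rewrite RintegralD//; exact: within_continuous_integrable. Qed.

Lemma right_power_integralZ p b k (f : R -> R) x : -1 < p -> x <= b ->
  {within `[x, b], continuous f} ->
  right_power_integral p b (fun t => k * f t) x = k * right_power_integral p b f x.
Proof.
move=> p1 xb cf; rewrite /right_power_integral -RintegralZl//.
  by apply: eq_Rintegral => t _; rewrite mulrCA.
exact: integrable_right_power.
Qed.

(** On ]a, a + tau[ the delayed factor looks back at the prescribed history, where a variation
    vanishes; the rest is translated. Vanishing is asked on the open interval only, so that the
    lemma also applies to the derivative of eta, which is computed at interior points. *)
Lemma Rintegral_delay (a b tau : R) (D f : R -> R) : 0 < tau < b - a ->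
  {within `[a, b], continuous D} -> {within `[a - tau, b], continuous f} ->
  (forall x, a - tau < x < a -> f x = 0) ->
  \int[mu]_(x in `[a, b]) (D x * f (x - tau)) =
  \int[mu]_(x in `[a, b - tau]) (D (x + tau) * f x).
Proof.
move=> tauab cD cf f0.
have cDf : {within `[a, b], continuous (fun x => D x * f (x - tau))}.
  apply: within_continuousM => //.
  have := within_continuous_comp_shift (tau := - tau) cf; rewrite !opprK subrK.
  by apply: within_continuous_itvS; lra.
rewrite (@Rintegral_itv_split _ _ _ (a + tau))//; last lra.
rewrite [X in X + _](_ : _ = 0) ?add0r; last first.
  rewrite /Rintegral integral_itv_bndoo.
    rewrite integral0_eq// => x /=; rewrite in_itv/= => xa.
    by rewrite f0 ?mulr0//; lra.
  apply/measurable_EFinP; apply: measurable_funS (within_continuous_measurable cDf) => //.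
  by move=> x /=; rewrite !in_itv/=; lra.
have E : b = (b - tau) + tau by rewrite subrK.
rewrite [in LHS]E Rintegral_shift; last 2 first.
- lra.
- by rewrite -E; apply: within_continuous_itvS cDf; lra.
by apply: eq_Rintegral => x _; rewrite addrK.
Qed.

(* V and W are the fractional operators applied to the variation eta; their
   continuity is part of admissibility. *)
Lemma weak_Euler_Lagrange (a b tau p q c1 c2 : R) (A F G D5 D6 V W eta deta : R -> R) :
  -1 < p -> -1 < q -> 0 < tau < b - a ->
  {within `[a, b], continuous A} -> {within `[a, b], continuous F} ->
  {within `[a, b], continuous G} -> {within `[a, b], continuous D5} ->
  {within `[a, b], continuous D6} ->
  {within `[a, b], continuous V} -> {within `[a, b], continuous W} ->
  (forall x, a <= x <= b -> V x = c1 * left_power_integral p a deta x) ->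
  (forall x, a <= x <= b -> W x = c2 * left_power_integral q a eta x) ->
  (forall x, a - tau <= x <= b -> quotient_filter_in `[a - tau, b] eta x 1 --> deta x) ->
  {within `[a - tau, b], continuous deta} ->
  (forall x, a - tau <= x <= a -> eta x = 0) -> eta b = 0 ->
  D6 b = 0 ->
  (forall x, a <= x <= b - tau -> quotient_filter_in `[a, b - tau]
     (fun t => c1 * right_power_integral p b F t + D6 (t + tau)) x 1
     --> A x + c2 * right_power_integral q b G x + D5 (x + tau)) ->
  (forall x, b - tau <= x <= b -> quotient_filter_in `[b - tau, b]
     (fun t => c1 * right_power_integral p b F t) x 1
     --> A x + c2 * right_power_integral q b G x) ->
  \int[mu]_(x in `[a, b]) (A x * eta x + F x * V x + G x * W x
    + D5 x * eta (x - tau) + D6 x * deta (x - tau)) = 0.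
Proof.
move=> p1 q1 /andP[tau0 taub] cA cF cG cD5 cD6 cV cW VE WE deta_ cdeta eta0 etab D6b EL1 EL2.
have at_ : a <= b - tau by lra.
have tb : b - tau <= b by lra.
have ab : a <= b by lra.
have ceta : {within `[a - tau, b], continuous eta}.
  apply/subspace_continuousP => x /=; rewrite in_itv/= => xab.
  exact: quotient_filter_in_continuous (deta_ _ xab).
have tab : a - tau <= a by lra.
have itvS1 c d (f : R -> R) : a - tau <= c -> d <= b ->
    {within `[a - tau, b], continuous f} -> {within `[c, d], continuous f}.
  exact: within_continuous_itvS.
have ceta_ab : {within `[a, b], continuous eta} by exact: itvS1 ceta.
have cdeta_ab : {within `[a, b], continuous deta} by exact: itvS1 cdeta.
have at1 : a < b - tau by lra.
have tb1 : b - tau < b by lra.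
have detal x : a <= x <= b - tau -> quotient_filter_in `[a, b - tau] eta x 1 --> deta x.
  move=> xab; apply: quotient_filter_inS (deta_ x _); last lra.
  by move=> z /=; rewrite !in_itv/=; lra.
have detar x : b - tau <= x <= b -> quotient_filter_in `[b - tau, b] eta x 1 --> deta x.
  move=> xab; apply: quotient_filter_inS (deta_ x _); last lra.
  by move=> z /=; rewrite !in_itv/=; lra.
have deta0 x : a - tau < x < a -> deta x = 0.
  move=> xa; have detax : is_derive x 1 eta (deta x).
    by apply: (@quotient_filter_in_is_derive _ (a - tau) b); [lra|apply: deta_; lra].
  rewrite -[LHS](@derive_val _ _ _ _ _ _ _ detax).
  rewrite (@near_eq_derive _ _ _ _ (cst 0)) ?derive_cst//.
  near=> z; apply: eta0.
  have : a - tau < z < a by near: z; apply: near_in_itvoo; rewrite in_itv.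
  lra.
have eta00 x : a - tau < x < a -> eta x = 0 by move=> xa; rewrite eta0//; lra.
have etaa : eta a = 0 by rewrite eta0//; lra.
have resl (f : R -> R) : {within `[a, b], continuous f} ->
    {within `[a, b - tau], continuous f} by exact: within_continuous_itvS.
have resr (f : R -> R) : {within `[a, b], continuous f} ->
    {within `[b - tau, b], continuous f} by exact: within_continuous_itvS.
have resx x (f : R -> R) : a <= x <= b -> {within `[a, b], continuous f} ->
    x <= b /\ {within `[x, b], continuous f}.
  by move=> /andP[ax xb] cf; split => //; apply: within_continuous_itvS cf.
have tauab : 0 < tau < b - a by rewrite tau0.
have shiftc (f : R -> R) : {within `[a - tau, b], continuous f} ->
    {within `[a, b], continuous (fun x => f (x - tau))}.
  move=> cf; have := within_continuous_comp_shift (tau := - tau) cf; rewrite !opprK subrK.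
  by apply: within_continuous_itvS; lra.
have advc (f : R -> R) : {within `[a, b], continuous f} ->
    {within `[a, b - tau], continuous (fun x => f (x + tau))}.
  by move=> /(within_continuous_comp_shift (tau := tau)); apply: within_continuous_itvS; lra.
(* After duality the undelayed terms become [H x * eta x + N x * deta x]. By hypothesis N has
   derivative H on [b - tau, b], and N + D6(. + tau) has derivative H + D5(. + tau) on [a, b - tau],
   so each integrand is that of a product rule. *)
pose N x := c1 * right_power_integral p b F x.
pose H x := A x + c2 * right_power_integral q b G x.
have cN : {within `[a, b], continuous N}.
  by apply: within_continuous_cst_mul; exact: right_power_integral_continuous.
have cH : {within `[a, b], continuous H}.
  apply: within_continuousDr => //.
  by apply: within_continuous_cst_mul; exact: right_power_integral_continuous.
have FV : \int[mu]_(x in `[a, b]) (F x * V x) = \int[mu]_(x in `[a, b]) (N x * deta x).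
  transitivity (\int[mu]_(x in `[a, b]) ((c1 * F x) * left_power_integral p a deta x)).
    apply: eq_Rintegral => x; rewrite inE/= in_itv/= => xab.
    by rewrite VE// mulrCA mulrA.
  rewrite power_integral_duality//; last exact: within_continuous_cst_mul.
  apply: eq_Rintegral => x; rewrite inE/= in_itv/= => xab.
  by have [xb cfx] := resx _ _ xab cF; rewrite right_power_integralZ.
have GW : \int[mu]_(x in `[a, b]) (G x * W x) =
    \int[mu]_(x in `[a, b]) (c2 * right_power_integral q b G x * eta x).
  transitivity (\int[mu]_(x in `[a, b]) ((c2 * G x) * left_power_integral q a eta x)).
    apply: eq_Rintegral => x; rewrite inE/= in_itv/= => xab.
    by rewrite WE// mulrCA mulrA.
  rewrite power_integral_duality//; last exact: within_continuous_cst_mul.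
  apply: eq_Rintegral => x; rewrite inE/= in_itv/= => xab.
  by have [xb cfx] := resx _ _ xab cG; rewrite right_power_integralZ.
have cAe : {within `[a, b], continuous (fun x => A x * eta x)} by exact: within_continuousM.
have cFV : {within `[a, b], continuous (fun x => F x * V x)} by exact: within_continuousM.
have cGW : {within `[a, b], continuous (fun x => G x * W x)} by exact: within_continuousM.
have cD5e : {within `[a, b], continuous (fun x => D5 x * eta (x - tau))}.
  by apply: within_continuousM => //; exact: shiftc.
have cD6e : {within `[a, b], continuous (fun x => D6 x * deta (x - tau))}.
  by apply: within_continuousM => //; exact: shiftc.
have cRe : {within `[a, b], continuous (fun x => c2 * right_power_integral q b G x * eta x)}.
  apply: within_continuousM => //.
  by apply: within_continuous_cst_mul; exact: right_power_integral_continuous.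
have cHN : {within `[a, b], continuous (fun x => H x * eta x + N x * deta x)}.
  by apply: within_continuousDr; exact: within_continuousM.
have cAF := within_continuousDr cAe cFV.
have cAFG := within_continuousDr cAF cGW.
have cAFG5 := within_continuousDr cAFG cD5e.
rewrite (Rintegral_within_continuousD cAFG5 cD6e) (Rintegral_within_continuousD cAFG cD5e).
rewrite (Rintegral_within_continuousD cAF cGW) (Rintegral_within_continuousD cAe cFV).
rewrite FV GW (Rintegral_delay tauab cD5 ceta eta00) (Rintegral_delay tauab cD6 cdeta deta0).
have cHe := within_continuousM cH ceta_ab.
have cNd := within_continuousM cN cdeta_ab.
have HN : \int[mu]_(x in `[a, b]) (H x * eta x + N x * deta x) =
    \int[mu]_(x in `[a, b]) (A x * eta x) + \int[mu]_(x in `[a, b]) (N x * deta x)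
    + \int[mu]_(x in `[a, b]) (c2 * right_power_integral q b G x * eta x).
  rewrite (Rintegral_within_continuousD cHe cNd).
  rewrite [in RHS]addrAC -(Rintegral_within_continuousD cAe cRe); congr (_ + _).
  by apply: eq_Rintegral => x _; rewrite mulrDl.
have c5 := within_continuousM (advc _ cD5) (resl _ ceta_ab).
have c6 := within_continuousM (advc _ cD6) (resl _ cdeta_ab).
have left_part : \int[mu]_(x in `[a, b - tau]) (H x * eta x + N x * deta x)
    + (\int[mu]_(x in `[a, b - tau]) (D5 (x + tau) * eta x)
       + \int[mu]_(x in `[a, b - tau]) (D6 (x + tau) * deta x))
    = (N (b - tau) + D6 (b - tau + tau)) * eta (b - tau)
      - (N a + D6 (a + tau)) * eta a.
  rewrite -(Rintegral_within_continuousD c5 c6).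
  rewrite -(Rintegral_within_continuousD (resl _ cHN) (within_continuousDr c5 c6)).
  rewrite -(integration_by_parts_within at1 EL1 detal).
  - by apply: eq_Rintegral => x _; rewrite !mulrDl addrACA.
  - by apply: within_continuousDr; [exact: resl|exact: advc].
  - exact: resl.
have right_part : \int[mu]_(x in `[b - tau, b]) (H x * eta x + N x * deta x)
    = N b * eta b - N (b - tau) * eta (b - tau).
  by apply: (integration_by_parts_within tb1 EL2 detar); exact: resr.
rewrite -HN (Rintegral_itv_split (c := b - tau) _ cHN); last by rewrite at_.
(* The terms [N (b - tau) * eta (b - tau)] have opposite signs, the delayed term carries the factor
   D6(b) = 0, and eta vanishes at a and b. *)
rewrite -[LHS]addrA [LHS]addrAC left_part right_part subrK D6b etaa etab.
by rewrite !mulr0 addr0 subr0 sub0r subrr.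
Unshelve. all: by end_near. Qed.

End weak_Euler_Lagrange.

(** * The delay problem *)

Section continuity_of_composites.
Context {R : realType}.

Lemma within_continuous_comp_in (T U V : topologicalType) (A : set T) (B : set U)
    (f : T -> U) (g : U -> V) : {within A, continuous f} -> {within B, continuous g} ->
  (forall x, A x -> B (f x)) -> {within A, continuous (fun x => g (f x))}.
Proof.
move=> /subspace_continuousP cf /subspace_continuousP cg AB.
apply/subspace_continuousP => x Ax; apply: cvg_trans (cg _ (AB _ Ax)) => P /= gP.
have H : \forall y \near within A (nbhs x), B (f y) -> P (g (f y)) := cf _ Ax _ gP.
change (\forall y \near within A (nbhs x), P (g (f y))).
rewrite !near_withinE in H *; apply: filterS H => y Hy Ay.
by apply: Hy => //; exact: AB.
Qed.

Lemma within_continuous_row n (A : set R) (f : R -> 'rV[R]_n.+1) :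
  (forall i, {within A, continuous (fun x => f x 0 i)}) -> {within A, continuous f}.
Proof.
move=> cf; apply/subspace_continuousP => x Ax; apply/cvg_ballP => e e0.
have H : \forall y \near within A (nbhs x), forall i, ball (f x 0 i) e (f y 0 i).
  apply: filter_forall => i; have /subspace_continuousP/(_ _ Ax) := cf i.
  by move=> /cvg_ballP/(_ e e0).
by apply: filterS H => y Hy; split => // i j; rewrite (ord1 i).
Qed.

Lemma within_continuous_shift_in (a b c d tau : R) (f : R -> R) :
  {within `[c, d], continuous f} -> c <= a + tau -> b + tau <= d ->
  {within `[a, b], continuous (fun x => f (x + tau))}.
Proof.
move=> cf ca bd; have := within_continuous_comp_shift (tau := tau) cf.
by apply: within_continuous_itvS; lra.
Qed.

Lemma C1_itv_continuous (a b : R) (f : R -> R) :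
  C1_itv `[a, b] f -> {within `[a, b], continuous f}.
Proof.
move=> [df _]; apply/subspace_continuousP => x xab.
exact: quotient_filter_in_continuous (df _ xab).
Qed.

End continuity_of_composites.

(** * Continuity along an admissible function *)

Section delay_problem_continuity.
Context {R : realType}.
Notation mu := (@lebesgue_measure R).
Variables (a b tau alpha beta yb : R) (phi : R -> R).
Variables (L : 'rV[R]_7 -> R) (l : 'rV[R]_4 -> R).
Hypotheses (htau : 0 < tau < b - a).
Hypotheses (hL : C1_on (slab a b) L) (hl : C1_on (slab a b) l).
Variable y : R -> R.
Hypothesis hy : admissible a b tau alpha beta yb phi y.

Lemma braces_slab x : a <= x <= b -> slab a b (braces a b tau alpha beta y x).
Proof. by rewrite /slab /braces/= mxE. Qed.

Lemma brackets_slab x : a <= x <= b -> slab a b (brackets a b tau alpha beta l y x).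
Proof. by rewrite /slab /brackets/= mxE. Qed.

Let cy : {within `[a - tau, b], continuous y}.
Proof. by case: hy => /C1_itv_continuous. Qed.

Lemma braces_continuous : {within `[a, b], continuous (braces a b tau alpha beta y)}.
Proof.
move: htau => tauab.
apply: within_continuous_row => i.
case: hy => _ [_ cC] [_ cI] _ _.
have cy1 : {within `[a, b], continuous y} by apply: within_continuous_itvS cy; lra.
rewrite (_ : (fun x => _) = fun x : R =>
  [:: x; y x; left_Caputo alpha a (dom a b tau) y x; left_integral beta a y x]`_i); last first.
  by apply/funext => x; rewrite mxE.
by case: i => -[|[|[|[|//]]]] /= _ //; apply: continuous_subspaceT => x.
Qed.

Lemma l_braces_continuous :
  {within `[a, b], continuous (fun x => l (braces a b tau alpha beta y x))}.
Proof.
apply: within_continuous_comp_in braces_continuous (C1_slab_continuous hl) _.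
by move=> x /=; rewrite in_itv/=; exact: braces_slab.
Qed.

Lemma zfun_continuous : {within `[a, b], continuous (zfun a b tau alpha beta l y)}.
Proof.
apply: parameterized_integral_continuous; first by move: htau; lra.
exact: within_continuous_integrable l_braces_continuous.
Qed.

Lemma brackets_continuous : {within `[a, b], continuous (brackets a b tau alpha beta l y)}.
Proof.
move: htau => tauab.
apply: within_continuous_row => i.
case: hy => -[_ cdy] [_ cC] [_ cI] _ _.
have cy1 : {within `[a, b], continuous y} by apply: within_continuous_itvS cy; lra.
rewrite (_ : (fun x => _) = fun x : R =>
  [:: x; y x; left_Caputo alpha a (dom a b tau) y x; left_integral beta a y x;
      zfun a b tau alpha beta l y x; y (x - tau); derive1_in (dom a b tau) y (x - tau)]`_i); last first.
  by apply/funext => x; rewrite mxE.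
case: i => -[|[|[|[|[|[|[|//]]]]]]] /= _ //.
- by apply: continuous_subspaceT => x.
- exact: zfun_continuous.
- by apply: within_continuous_shift_in cy _ _; lra.
- by apply: within_continuous_shift_in cdy _ _; lra.
Qed.

(** Gives integrability of the integrand of [J], so that the values of [J] at two admissible
    functions can be subtracted under one integral sign. *)
Lemma L_brackets_continuous :
  {within `[a, b], continuous (fun x => L (brackets a b tau alpha beta l y x))}.
Proof.
apply: within_continuous_comp_in brackets_continuous (C1_slab_continuous hL) _.
by move=> x /=; rewrite in_itv/=; exact: brackets_slab.
Qed.

Lemma dL_continuous i : {within `[a, b], continuous (dL a b tau alpha beta L l i y)}.
Proof.
apply: within_continuous_comp_in brackets_continuous (hL i).2 _.
by move=> x /=; rewrite in_itv/=; exact: brackets_slab.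
Qed.

Lemma dl_continuous i : {within `[a, b], continuous (dl a b tau alpha beta l i y)}.
Proof.
apply: within_continuous_comp_in braces_continuous (hl i).2 _.
by move=> x /=; rewrite in_itv/=; exact: braces_slab.
Qed.

(** This identifies [intLz] as the dual counterpart of the integral defining z. The kernel is 1 even
    at t = x, since 0^0 = 1. *)
Lemma intLzE x : intLz a b tau alpha beta L l y x =
  right_power_integral 0 b (dL a b tau alpha beta L l 4 y) x.
Proof. by apply: eq_Rintegral => t _; rewrite powRr0 mul1r. Qed.

Lemma intLz_continuous : {within `[a, b], continuous (intLz a b tau alpha beta L l y)}.
Proof.
have -> : intLz a b tau alpha beta L l y =
    right_power_integral 0 b (dL a b tau alpha beta L l 4 y).
  by apply/funext => x; exact: intLzE.
by apply: right_power_integral_continuous; [lra|exact: dL_continuous].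
Qed.

End delay_problem_continuity.

(** * Sufficiency of the Euler-Lagrange conditions *)

Section sufficiency.
Context {R : realType}.
Notation mu := (@lebesgue_measure R).

Lemma sum_ord7_from1 (F : 'I_7 -> R) :
  \sum_(i < 7 | (nat_of_ord (1%R : 'I_7) <= i)%N) F i = F 1 + F 2 + F 3 + F 4 + F 5 + F 6.
Proof.
rewrite big_mkcond !big_ord_recl big_ord0 /= add0r addr0 !addrA.
by congr (_ + _ + _ + _ + _ + _); congr F; exact: val_inj.
Qed.

Lemma sum_ord4_from1 (F : 'I_4 -> R) :
  \sum_(i < 4 | (nat_of_ord (1%R : 'I_4) <= i)%N) F i = F 1 + F 2 + F 3.
Proof.
rewrite big_mkcond !big_ord_recl big_ord0 /= add0r addr0 !addrA.
by congr (_ + _ + _); congr F; exact: val_inj.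
Qed.

(** With i standing for [intLz], the coefficients of h, v and w on the right are the combined
    functions [A], [F] and [G] below. *)
Let integrand_algebra (p1 p2 p3 p5 p6 i l1 l2 l3 h v w : R) :
  p1 * h + p2 * v + p3 * w + p5 + p6 + i * (l1 * h + l2 * v + l3 * w) =
  (p1 + i * l1) * h + (p2 + i * l2) * v + (p3 + i * l3) * w + p5 + p6.
Proof. by ring. Qed.

Let integrand_le (p1 p2 p3 p5 p6 u v : R) : u <= v ->
  p1 + p2 + p3 + p5 + p6 + u <= p1 + p2 + p3 + v + p5 + p6.
Proof. by lra. Qed.

Let cvg_to_eq (Q : set_system R) (u v : R) : Q --> v -> u = v -> Q --> u.
Proof. by move=> Qv ->. Qed.

(** Isolates e1, ..., e5, which stand for the derivatives, on one side; k1 and k2 are the reciprocal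
    Gamma values. *)
Let Euler_Lagrange_before_algebra (k1 k2 u e1 e2 r1 t1 m e3 e4 r2 t2 v e5 : R) :
  u + - k1 * e1 - k1 * e2 + k2 * r1 + k2 * t1 + m + - k1 * e3 - k1 * e4
    + k2 * r2 + k2 * t2 + v - e5 = 0 ->
  u + m + k2 * (r1 + t1 + (r2 + t2)) + v = k1 * (e1 + e2 + (e3 + e4)) + e5.
Proof. by move=> E; apply/eqP; rewrite -subr_eq0 -[X in _ == X]E; apply/eqP; ring. Qed.

Let Euler_Lagrange_after_algebra (k1 k2 u e1 r1 m e2 r2 : R) :
  u + - k1 * e1 + k2 * r1 + m + - k1 * e2 + k2 * r2 = 0 ->
  u + m + k2 * (r1 + r2) = k1 * (e1 + e2).
Proof. by move=> E; apply/eqP; rewrite -subr_eq0 -[X in _ == X]E; apply/eqP; ring. Qed.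

Lemma right_power_integralD p b (f g : R -> R) x : -1 < p -> x <= b ->
  {within `[x, b], continuous f} -> {within `[x, b], continuous g} ->
  right_power_integral p b (fun t => f t + g t) x =
  right_power_integral p b f x + right_power_integral p b g x.
Proof.
move=> p1 xb cf cg; rewrite /right_power_integral -RintegralD//.
- by apply: eq_Rintegral => t _; rewrite mulrDr.
- exact: integrable_right_power.
- exact: integrable_right_power.
Qed.

Variables (a b tau alpha beta yb : R) (phi : R -> R).
Variables (L : 'rV[R]_7 -> R) (l : 'rV[R]_4 -> R).
Hypotheses (halpha : 0 < alpha < 1) (hbeta : 0 < beta) (htau : 0 < tau < b - a).
Hypotheses (hL : C1_on (slab a b) L) (hl : C1_on (slab a b) l).
Variable y : R -> R.
Hypothesis hy : admissible a b tau alpha beta yb phi y.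

Local Notation Ly i := (dL a b tau alpha beta L l i y).
Local Notation ly i := (dl a b tau alpha beta l i y).
Local Notation iLz := (intLz a b tau alpha beta L l y).
Local Notation c1 := (Gamma (1 - alpha))^-1.
Local Notation c2 := (Gamma beta)^-1.
Let Zlv := fun x => iLz x * ly 2 x.
Let Zlw := fun x => iLz x * ly 3 x.
(** [A], [F] and [G] are the coefficients of eta and of its Caputo derivative and fractional
    integral, once the variation of z has been moved onto [iLz]. *)
Let A := fun x => Ly 1 x + iLz x * ly 1 x.
Let F := fun x => Ly 2 x + Zlv x.
Let G := fun x => Ly 3 x + Zlw x.

Let cLy i : {within `[a, b], continuous (Ly i)}.
Proof. exact: (dL_continuous htau hL hl hy). Qed.

Let cly i : {within `[a, b], continuous (ly i)}.
Proof. exact: (dl_continuous htau hl hy). Qed.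

Let ciLz : {within `[a, b], continuous iLz}.
Proof. exact: (intLz_continuous htau hL hl hy). Qed.

Let cZlv : {within `[a, b], continuous Zlv}. Proof. exact: within_continuousM. Qed.
Let cZlw : {within `[a, b], continuous Zlw}. Proof. exact: within_continuousM. Qed.

Let restrict_b x (f : R -> R) : a <= x -> {within `[a, b], continuous f} ->
  {within `[x, b], continuous f}.
Proof. by move=> ax; apply: within_continuous_itvS. Qed.

(** The four fractional derivatives in (ii) are two pairs, each a kernel up to b - tau and its tail.
    Their sum is the derivative of one integral up to b with density [F], to which the delayed term
    is added. *)
Lemma Euler_Lagrange_beforeP : Euler_Lagrange_before a b tau alpha beta L l y ->
  forall x, a <= x <= b - tau -> quotient_filter_in `[a, b - tau]
    (fun t => c1 * right_power_integral (- alpha) b F t + Ly 6 (t + tau)) x 1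
    --> A x + c2 * right_power_integral (beta - 1) b G x + Ly 5 (x + tau).
Proof.
move=> hii x xab; move: (htau) (halpha) (hbeta) => tauab alpha01 beta0.
have p1 : -1 < - alpha by lra.
have q1 : -1 < beta - 1 by lra.
have tb : b - tau <= b by lra.
have splitK p (f : R -> R) z : -1 < p -> a <= z <= b - tau -> {within `[a, b], continuous f} ->
    right_power_integral p b f z = right_power_integral p (b - tau) f z
      + \int[mu]_(t in `[b - tau, b]) ((t - z) `^ p * f t).
  move=> pp /andP[az zb] cf; apply: right_power_integral_split => //.
  exact: restrict_b.
have FE p (f g : R -> R) z : -1 < p -> a <= z <= b -> {within `[a, b], continuous f} ->
   {within `[a, b], continuous g} -> right_power_integral p b (fun t => f t + g t) z
   = right_power_integral p b f z + right_power_integral p b g z.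
  by move=> pp /andP[az zb] cf cg; apply: right_power_integralD => //; exact: restrict_b.
have xb : a <= x <= b by lra.
have [[d1 d2 d3 d4 d5] EL] := hii x xab.
rewrite (FE _ _ _ _ q1 xb (cLy (i := 3)) cZlw) (splitK _ _ _ q1 xab (cLy (i := 3))) (splitK _ _ _ q1 xab cZlw).
have H := quotient_filter_inD (quotient_filter_inZ (k := c1) (quotient_filter_inD
   (quotient_filter_inD d1 d2) (quotient_filter_inD d3 d4))) d5.
rewrite /right_RL /right_integral in EL; have E := Euler_Lagrange_before_algebra EL.
(* The equation trades the sum of derivatives for an expression without derivatives. *)
apply: (cvg_to_eq _ E).
apply: (eq_quotient_filter_in _ _ H) => [|t]; first by rewrite /= in_itv.
rewrite inE/= in_itv/= => tab; have tab' : a <= t <= b.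
  by case/andP : tab => -> /le_trans; apply.
rewrite (FE _ _ _ _ p1 tab' (cLy (i := 2)) cZlv) (splitK _ _ _ p1 tab (cLy (i := 2))).
by rewrite (splitK _ _ _ p1 tab cZlv).
Qed.

Lemma Euler_Lagrange_afterP : Euler_Lagrange_after a b tau alpha beta L l y ->
  forall x, b - tau <= x <= b -> quotient_filter_in `[b - tau, b]
    (fun t => c1 * right_power_integral (- alpha) b F t) x 1
    --> A x + c2 * right_power_integral (beta - 1) b G x.
Proof.
move=> hiii x xab; move: (htau) (halpha) (hbeta) => tauab alpha01 beta0.
have p1 : -1 < - alpha by lra.
have q1 : -1 < beta - 1 by lra.
have at_ : a <= b - tau by lra.
have FE p (f g : R -> R) z : -1 < p -> b - tau <= z <= b ->
   {within `[a, b], continuous f} -> {within `[a, b], continuous g} ->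
   right_power_integral p b (fun t => f t + g t) z
   = right_power_integral p b f z + right_power_integral p b g z.
  move=> pp /andP[/(le_trans at_) az zb] cf cg.
  by apply: right_power_integralD => //; exact: restrict_b.
have [[d1 d2] EL] := hiii x xab.
rewrite (FE _ _ _ _ q1 xab (cLy (i := 3)) cZlw).
have H := quotient_filter_inZ (k := c1) (quotient_filter_inD d1 d2).
rewrite /right_RL /right_integral in EL; have E := Euler_Lagrange_after_algebra EL.
apply: (cvg_to_eq _ E).
apply: (eq_quotient_filter_in _ _ H) => [|t]; first by rewrite /= in_itv.
rewrite inE/= in_itv/= => tab.
by rewrite (FE _ _ _ _ p1 tab (cLy (i := 2)) cZlv).
Qed.


Lemma left_power_integral0 (g : R -> R) :
  left_power_integral 0 a g = fun x => \int[mu]_(t in `[a, x]) g t.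
Proof.
by apply/funext => x; apply: eq_Rintegral => t _; rewrite powRr0 mul1r.
Qed.

Variable yt : R -> R.
Hypothesis hyt : admissible a b tau alpha beta yb phi yt.

Let eta := fun x => yt x - y x.
Let deta := fun x => derive1_in (dom a b tau) yt x - derive1_in (dom a b tau) y x.
Let V := fun x =>
  left_Caputo alpha a (dom a b tau) yt x - left_Caputo alpha a (dom a b tau) y x.
Let W := fun x => left_integral beta a yt x - left_integral beta a y x.
Let dz := fun x => ly 1 x * eta x + ly 2 x * V x + ly 3 x * W x.

Let eta_deta x : a - tau <= x <= b -> quotient_filter_in `[a - tau, b] eta x 1 --> deta x.
Proof.
move=> xab; have [[dyt _] _ _ _ _] := hyt; have [[dy _] _ _ _ _] := hy.
have xD : dom a b tau x by rewrite /dom/= in_itv.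
have := quotient_filter_inD (dyt _ xD) (quotient_filter_inZ (k := -1) (dy _ xD)).
rewrite mulN1r (_ : (fun t => _) = eta)//.
by apply/funext => t; rewrite mulN1r.
Qed.

Let cdeta : {within `[a - tau, b], continuous deta}.
Proof.
have [[_ dyt] _ _ _ _] := hyt; have [[_ dy] _ _ _ _] := hy.
exact: within_continuousBr dyt dy.
Qed.

Let cV : {within `[a, b], continuous V}.
Proof.
have [_ [_ Ct] _ _ _] := hyt; have [_ [_ C] _ _ _] := hy.
exact: within_continuousBr Ct C.
Qed.

Let cW : {within `[a, b], continuous W}.
Proof.
have [_ _ [_ Ct] _ _] := hyt; have [_ _ [_ C] _ _] := hy.
exact: within_continuousBr Ct C.
Qed.

Let ceta : {within `[a - tau, b], continuous eta}.
Proof.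
apply/subspace_continuousP => x /=; rewrite in_itv/= => xab.
exact: quotient_filter_in_continuous (eta_deta xab).
Qed.

Let ceta_ab : {within `[a, b], continuous eta}.
Proof. by move: htau => tauab; apply: within_continuous_itvS ceta; lra. Qed.

(** The existence clause of admissibility enters here: the difference of two Caputo integrals is the
    integral of the difference because both integrands are integrable. *)
Let VE x : a <= x <= b -> V x = c1 * left_power_integral (- alpha) a deta x.
Proof.
move=> xab; have [_ [/(_ _ xab) it _] _ _ _] := hyt; have [_ [/(_ _ xab) i _] _ _ _] := hy.
rewrite /V /left_Caputo -mulrBr -RintegralB//.
by congr (_ * _); apply: eq_Rintegral => t _; rewrite -mulrBr.
Qed.

Let WE x : a <= x <= b -> W x = c2 * left_power_integral (beta - 1) a eta x.
Proof.
move=> xab; have [_ _ [/(_ _ xab) it _] _ _] := hyt; have [_ _ [/(_ _ xab) i _] _ _] := hy.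
rewrite /W /left_integral -mulrBr -RintegralB//.
by congr (_ * _); apply: eq_Rintegral => t _; rewrite -mulrBr.
Qed.

Let cdz : {within `[a, b], continuous dz}.
Proof.
apply: within_continuousDr; last exact: within_continuousM.
by apply: within_continuousDr; exact: within_continuousM.
Qed.

Let convex_gradient x : convex_from 1 (slab a b) L -> a <= x <= b ->
  Ly 1 x * eta x + Ly 2 x * V x + Ly 3 x * W x
    + Ly 4 x * (zfun a b tau alpha beta l yt x - zfun a b tau alpha beta l y x)
    + Ly 5 x * eta (x - tau) + Ly 6 x * deta (x - tau)
  <= L (brackets a b tau alpha beta l yt x) - L (brackets a b tau alpha beta l y x).
Proof.
move=> [_ cL] xab.
have := cL _ _ (brackets_slab tau alpha beta l y xab) (brackets_slab tau alpha beta l yt xab).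
rewrite sum_ord7_from1 /brackets !mxE/=; apply.
by move=> i; rewrite ltnS leqn0 => /eqP i0; rewrite !mxE i0.
Qed.

Let gradientl t : a <= t <= b ->
  \sum_(i < 4 | (nat_of_ord (1%R : 'I_4) <= i)%N) partial (slab a b) l i (braces a b tau alpha beta y t)
    * (braces a b tau alpha beta yt t 0 i - braces a b tau alpha beta y t 0 i) = dz t.
Proof. by move=> tab; rewrite sum_ord4_from1 /braces !mxE. Qed.

(** The linearized increment of z is written with exponent 0 so that [power_integral_duality]
    applies to it directly. *)
Let zfun_variation x : a <= x <= b ->
  (convex_from 1 (slab a b) l /\ forall x, a <= x <= b -> 0 <= Ly 4 x) \/
  (concave_from 1 (slab a b) l /\ forall x, a <= x <= b -> Ly 4 x <= 0) ->
  Ly 4 x * left_power_integral 0 a dz x <=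
  Ly 4 x * (zfun a b tau alpha beta l yt x - zfun a b tau alpha beta l y x).
Proof.
move=> xab hcases; rewrite left_power_integral0.
have [ax xb] := andP xab.
have sub (f : R -> R) : {within `[a, b], continuous f} ->
    mu.-integrable `[a, x] (EFin \o f).
  move=> cf; apply: within_continuous_integrable.
  exact: within_continuous_itvS (lexx a) xb cf.
have ily := sub _ (l_braces_continuous htau hl hy).
have ilyt := sub _ (l_braces_continuous htau hl hyt).
have idz := sub _ cdz.
have tb t : a <= t <= x -> a <= t <= b.
  by move=> /andP[-> tx]; exact: le_trans tx xb.
have first t : forall i : 'I_4, (i < (1%R : 'I_4))%N ->
    braces a b tau alpha beta yt t 0 i = braces a b tau alpha beta y t 0 i.
  by move=> i; rewrite ltnS leqn0 => /eqP i0; rewrite !mxE i0.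
rewrite /zfun -RintegralB//.
case: hcases => -[[_ cl] sgn].
  rewrite ler_wpM2l ?sgn//; apply: le_Rintegral => //; first exact: integrable_subr.
  move=> t /=; rewrite in_itv/= => /tb tab; rewrite -gradientl//.
  by apply: cl; [exact: braces_slab..|exact: first].
(* Multiplication by a nonpositive factor reverses the concavity inequality, so the same lower bound
   results. *)
rewrite ler_wnM2l ?sgn//; apply: le_Rintegral => //; first exact: integrable_subr.
move=> t /=; rewrite in_itv/= => /tb tab; rewrite -gradientl//.
by apply: cl; [exact: braces_slab..|exact: first].
Qed.

Lemma J_le_of_Euler_Lagrange :
  boundary_condition a b tau alpha beta L l y ->
  Euler_Lagrange_before a b tau alpha beta L l y ->
  Euler_Lagrange_after a b tau alpha beta L l y ->
  convex_from 1 (slab a b) L ->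
  (convex_from 1 (slab a b) l /\ forall x, a <= x <= b -> 0 <= Ly 4 x) \/
  (concave_from 1 (slab a b) l /\ forall x, a <= x <= b -> Ly 4 x <= 0) ->
  J a b tau alpha beta L l y <= J a b tau alpha beta L l yt.
Proof.
have m10 : -1 < 0 :> R by lra.
move=> hi hii hiii cL hcases.
have [tau0 taub] := andP htau.
have [al0 al1] := andP halpha.
have p1 : -1 < - alpha by rewrite ltrN2.
have q1 : -1 < beta - 1 by rewrite -[X in X < _]add0r ltrD2r.
have ab : a <= b by rewrite -subr_ge0 ltW// (lt_trans tau0).
have [_ _ _ yb_ yphi] := hy; have [_ _ _ ytb ytphi] := hyt.
have eta0 x : a - tau <= x <= a -> eta x = 0.
  by move=> xa; rewrite /eta yphi// ytphi// subrr.
have etab : eta b = 0 by rewrite /eta ytb yb_ subrr.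
have cA : {within `[a, b], continuous A}.
  exact: within_continuousDr (cLy (i := 1)) (within_continuousM ciLz (cly (i := 1))).
have cF : {within `[a, b], continuous F} by exact: within_continuousDr (cLy (i := 2)) cZlv.
have cG : {within `[a, b], continuous G} by exact: within_continuousDr (cLy (i := 3)) cZlw.
have weak := weak_Euler_Lagrange p1 q1 htau cA cF cG (cLy (i := 5)) (cLy (i := 6))
  cV cW VE WE eta_deta cdeta eta0 etab hi (Euler_Lagrange_beforeP hii)
  (Euler_Lagrange_afterP hiii).
have cZ : {within `[a, b], continuous (left_power_integral 0 a dz)}.
  rewrite left_power_integral0; apply: parameterized_integral_continuous => //.
  exact: within_continuous_integrable.
have shiftc (f : R -> R) : {within `[a - tau, b], continuous f} ->
    {within `[a, b], continuous (fun x => f (x - tau))}.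
  move=> cf; apply: (within_continuous_shift_in cf) => //.
  by rewrite gerBl ltW.
pose E x := Ly 1 x * eta x + Ly 2 x * V x + Ly 3 x * W x
    + Ly 5 x * eta (x - tau) + Ly 6 x * deta (x - tau).
have cE : {within `[a, b], continuous E}.
  apply: within_continuousDr; last by apply: within_continuousM => //; exact: shiftc.
  apply: within_continuousDr; last by apply: within_continuousM => //; exact: shiftc.
  apply: within_continuousDr; last exact: within_continuousM.
  by apply: within_continuousDr; exact: within_continuousM.
have c4Z : {within `[a, b], continuous (fun x => Ly 4 x * left_power_integral 0 a dz x)}.
  exact: within_continuousM.
have cidz : {within `[a, b], continuous (fun x => iLz x * dz x)} by exact: within_continuousM.
have E0 : \int[mu]_(x in `[a, b]) (E x + Ly 4 x * left_power_integral 0 a dz x) = 0.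
  (* Duality with p = 0 replaces [Ly 4] times the integral of [dz] by [iLz * dz]; collecting
     coefficients then gives the integrand of [weak]. *)
  rewrite Rintegral_within_continuousD// power_integral_duality//.
  rewrite -[RHS]weak -[X in _ + X](_ : \int[mu]_(x in `[a, b]) (iLz x * dz x) = _); last first.
    by apply: eq_Rintegral => x _; rewrite intLzE.
  rewrite -Rintegral_within_continuousD//.
  by apply: eq_Rintegral => x _; exact: integrand_algebra.
have iL := within_continuous_integrable (L_brackets_continuous htau hL hl hy).
have iLt := within_continuous_integrable (L_brackets_continuous htau hL hl hyt).
rewrite -subr_ge0 /J -RintegralB// -[X in X <= _]E0.
apply: le_Rintegral => //.
- by apply: within_continuous_integrable; exact: within_continuousDr.
- exact: integrable_subr.
move=> x /=; rewrite in_itv/= => xab.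
apply: le_trans (convex_gradient cL xab).
have := zfun_variation xab hcases.
exact: integrand_le.
Qed.

End sufficiency.

Theorem theorem8 (R : realType) (a b tau alpha beta yb : R) (phi : R -> R)
    (L : 'rV[R]_7 -> R) (l : 'rV[R]_4 -> R) (y : R -> R)
    (halpha : 0 < alpha < 1) (hbeta : 0 < beta) (htau : 0 < tau < b - a)
    (hL : C1_on (slab a b) L) (hl : C1_on (slab a b) l)
    (hy : admissible a b tau alpha beta yb phi y)
    (hi : boundary_condition a b tau alpha beta L l y)
    (hii : Euler_Lagrange_before a b tau alpha beta L l y)
    (hiii : Euler_Lagrange_after a b tau alpha beta L l y)
    (hLconvex : convex_from 1 (slab a b) L)
    (hcases :
      (convex_from 1 (slab a b) l /\
         forall x, a <= x <= b -> 0 <= dL a b tau alpha beta L l 4 y x) \/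
      (concave_from 1 (slab a b) l /\
         forall x, a <= x <= b -> dL a b tau alpha beta L l 4 y x <= 0)) :
  forall yt : R -> R, admissible a b tau alpha beta yb phi yt ->
    J a b tau alpha beta L l y <= J a b tau alpha beta L l yt.
Proof.
move=> yt hyt.
exact: (J_le_of_Euler_Lagrange halpha hbeta htau hL hl hy hyt hi hii hiii hLconvex hcases).
Qed.
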